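(* Let $n\ge 1$, let $J:\mathbb{R}^n\to\mathbb{R}$ be locally Lipschitz, let $a>0$, and let $\hat\omega_1,\dots,\hat\omega_n>0$ be rationally independent, i.e. $\ell^\top\hat\omega\neq 0$ for every $\ell\in\mathbb{Q}^n\setminus\{0\}$, where $\hat\omega=(\hat\omega_1,\dots,\hat\omega_n)^\top$. For $k,\omega>0$ consider the extremum seeking system $$\dot{\hat x}(t)=-k\,J\bigl(\hat x(t)+S(t)\bigr)M(t),\qquad \hat x(t_0)=x_0,$$ with $t_0\in\mathbb{R}$, $x_0\in\mathbb{R}^n$, and with $S,M$ having components $$S_i(t)=a\sin(\omega\hat\omega_i t),\qquad M_i(t)=\frac{2^n}{a}\sin(\omega\hat\omega_i t)\prod_{j\neq i}\cos^2(\omega\hat\omega_j t),\qquad i=1,\dots,n.$$ Define $$J_a(x)=\int_{[-1,1]^n}J(x+au)\,\kappa(u)\,\mathrm{d}u,\qquad \kappa(u)=\left(\frac{2}{\pi}\right)^n\prod_{j=1}^n\sqrt{1-u_j^2}.$$ Suppose that $x_a\in\mathbb{R}^n$ is a globally uniformly asymptotically stable (GUAS) equilibrium of the gradient flow $$\frac{\mathrm{d}z}{\mathrm{d}s}=-\nabla J_a(z).$$ Then $x_a$ is practically globally uniformly asymptotically stable (PGUAS) with respect to the parameter $\varepsilon=k/\omega$ for the extremum seeking system in slow time $s=kt$. In particular, there exists $\beta\in\mathcal{KL}$ such that for every $\Delta,\nu>0$ there exists $\varepsilon^*(\Delta,\nu)>0$ such that, whenever $0<\varepsilon=k/\omega<\varepsilon^*(\Delta,\nu)$,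 every solution with $\|\hat x(t_0)-x_a\|\le\Delta$ (for any $t_0\in\mathbb{R}$) satisfies $$\|\hat x(t)-x_a\|\le\beta\bigl(\|\hat x(t_0)-x_a\|,\,k(t-t_0)\bigr)+\nu,\qquad t\ge t_0.$$
   Context: $\|\cdot\|$ is the Euclidean norm. A function $\beta:\mathbb{R}_{\ge0}\times\mathbb{R}_{\ge0}\to\mathbb{R}_{\ge0}$ is of class $\mathcal{KL}$ if it is continuous, for each fixed $s\ge 0$ the map $r\mapsto\beta(r,s)$ is strictly increasing with $\beta(0,s)=0$, and for each fixed $r>0$ the map $s\mapsto\beta(r,s)$ is decreasing with $\beta(r,s)\to0$ as $s\to\infty$. GUAS: a point $p$ is GUAS for $\dot z=g(t,z)$, $z(t_0)=x_0$, if there exists $\beta\in\mathcal{KL}$ such that every solution is defined for all $t\ge t_0$ and satisfies $\|z(t)-p\|\le\beta(\|x_0-p\|,t-t_0)$ for $t\ge t_0$. PGUAS: a point $p$ is PGUAS for a parameter-dependent system $\dot x=f(t,x,\varepsilon)$, $x(t_0)=x_0$, $0<\varepsilon\le\varepsilon_0$, if there exists $\beta\in\mathcal{KL}$ such that for every $\Delta,\nu>0$ there exists $\varepsilon^*(\Delta,\nu)\in(0,\varepsilon_0]$ such that for every $t_0\in\mathbb{R}$, every $x_0$ with $\|x_0-p\|\le\Delta$ and every $0<\varepsilon<\varepsilon^*(\Delta,\nu)$, the corresponding solution is defined for all $t\ge t_0$ and satisfies $\|x(t,\varepsilon)-p\|\le\beta(\|x_0-p\|,t-t_0)+\nu$ for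 all $t\ge t_0$; here $\beta$ is independent of $\Delta$, $\nu$ and $\varepsilon$. In slow time $s=kt$, the function $\tilde x(s)=\hat x(s/k)$ solves $\frac{\mathrm{d}\tilde x}{\mathrm{d}s}=F(\tilde x,\hat\omega s/\varepsilon)$ with $\varepsilon=k/\omega$ and $F_i(x,\theta)=-\frac{2^n}{a}J(x+a\sin\theta)\sin\theta_i\prod_{j\ne i}\cos^2\theta_j$ ($\sin\theta$ componentwise); ''PGUAS in slow time'' refers to this $\varepsilon$-dependent system. The function $J_a$ is differentiable with locally Lipschitz gradient. *)

(* Defs.v *)
From HB Require Import structures.
From mathcomp Require Import all_boot all_order all_algebra.
From mathcomp Require Import all_classical all_reals all_analysis.

Set Implicit Arguments.
Unset Strict Implicit.
Unset Printing Implicit Defensive.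

Import Order.TTheory GRing.Theory Num.Theory.
Import numFieldNormedType.Exports.

Local Open Scope classical_set_scope.
Local Open Scope ring_scope.

(* The library norm `|_| on 'rV[R]_n is the sup norm, hence this definition.
   The topology (and so continuity and derivatives) is the same for both. *)
Definition enorm (R : realType) (n : nat) (v : 'rV[R]_n) : R :=
  Num.sqrt (\sum_(i < n) v ord0 i ^+ 2).

(* Lipschitz near every point, with respect to the sup norm: on R^n the notion
   does not depend on the norm, only the local constants do. *)
Definition locally_lipschitz (R : realType) (n : nat) (f : 'rV[R]_n -> R) :=
  forall x : 'rV[R]_n, exists2 U : set 'rV[R]_n, nbhs x U & [lipschitz f y | y in U].

Definition rationally_independent (R : realType) (n : nat) (w : 'rV[R]_n) :=
  forall l : 'rV[rat]_n, l != 0 ->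
    \sum_(i < n) ratr (l ord0 i) * w ord0 i != 0.

(* Functions of class KL on [0, +oo[ x [0, +oo[; the values outside of this
   quadrant are irrelevant. *)
Definition class_KL (R : realType) (beta : R -> R -> R) : Prop :=
  [/\ forall r s, 0 <= r -> 0 <= s -> 0 <= beta r s,
      {within [set p : R * R | 0 <= p.1 /\ 0 <= p.2],
        continuous (fun p : R * R => beta p.1 p.2)},
      forall s, 0 <= s ->
        beta 0 s = 0 /\
        (forall r1 r2, 0 <= r1 -> r1 < r2 -> beta r1 s < beta r2 s) &
      forall r, 0 < r ->
        (forall s1 s2, 0 <= s1 -> s1 <= s2 -> beta r s2 <= beta r s1) /\
        beta r s @[s --> +oo] --> (0 : R)].

(* x solves x' = g(t, x), x(t0) = x0, on [t0, T[, where T may be +oo.  At t0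
   only continuity is required; for continuous g the one-sided differential
   equation at t0 follows. *)
Definition is_solution (R : realType) (n : nat) (g : R -> 'rV[R]_n -> 'rV[R]_n)
    (t0 : R) (x0 : 'rV[R]_n) (T : \bar R) (x : R -> 'rV[R]_n) : Prop :=
  [/\ (t0%:E < T)%E,
      x t0 = x0,
      {within [set t : R | t0 <= t /\ (t%:E < T)%E], continuous x} &
      forall t : R, t0 < t -> (t%:E < T)%E -> is_derive t 1 x (g t (x t))].

Definition is_maximal_solution (R : realType) (n : nat)
    (g : R -> 'rV[R]_n -> 'rV[R]_n)
    (t0 : R) (x0 : 'rV[R]_n) (T : \bar R) (x : R -> 'rV[R]_n) : Prop :=
  is_solution g t0 x0 T x /\
  forall (T' : \bar R) (y : R -> 'rV[R]_n),
    (T < T')%E -> is_solution g t0 x0 T' y ->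
    ~ (forall t : R, t0 <= t -> (t%:E < T)%E -> y t = x t).

(* "Every solution is defined for all t >= t0 and satisfies P t (x t) there".
   "Solution" means non-continuable solution, and a solution has to exist. *)
Definition solutions_global_with (R : realType) (n : nat)
    (g : R -> 'rV[R]_n -> 'rV[R]_n) (t0 : R) (x0 : 'rV[R]_n)
    (P : R -> 'rV[R]_n -> Prop) : Prop :=
  (exists T x, is_maximal_solution g t0 x0 T x) /\
  (forall T x, is_maximal_solution g t0 x0 T x ->
     T = +oo%E /\ forall t : R, t0 <= t -> P t (x t)).

Definition is_equilibrium (R : realType) (n : nat)
    (g : R -> 'rV[R]_n -> 'rV[R]_n) (p : 'rV[R]_n) : Prop :=
  forall t, g t p = 0.

Definition GUAS (R : realType) (n : nat)
    (g : R -> 'rV[R]_n -> 'rV[R]_n) (p : 'rV[R]_n) : Prop :=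
  exists2 beta : R -> R -> R, class_KL beta &
    forall (t0 : R) (x0 : 'rV[R]_n),
      solutions_global_with g t0 x0
        (fun t z => enorm (z - p) <= beta (enorm (x0 - p)) (t - t0)).

(* f t x eps is the right-hand side, for parameters 0 < eps <= eps0. *)
Definition PGUAS (R : realType) (n : nat) (eps0 : R)
    (f : R -> 'rV[R]_n -> R -> 'rV[R]_n) (p : 'rV[R]_n) : Prop :=
  exists2 beta : R -> R -> R, class_KL beta &
    forall Delta nu : R, 0 < Delta -> 0 < nu ->
    exists2 eps_star : R, 0 < eps_star <= eps0 &
      forall (t0 : R) (x0 : 'rV[R]_n) (eps : R),
        enorm (x0 - p) <= Delta -> 0 < eps < eps_star ->
        solutions_global_with (fun t x => f t x eps) t0 x0
          (fun t x => enorm (x - p) <= beta (enorm (x0 - p)) (t - t0) + nu).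

Definition gradient (R : realType) (n : nat) (f : 'rV[R]_n -> R)
    (x : 'rV[R]_n) : 'rV[R]_n :=
  \row_(i < n) 'D_(delta_mx ord0 i) f x.

(* The integral of f over the cube [-1,1]^n, as an iterated one-dimensional
   Lebesgue integral.  It is only applied to continuous f, for which it is the
   n-dimensional (Riemann or Lebesgue) integral, in any order of integration. *)
Fixpoint cube_integral (R : realType) (n : nat) : ('rV[R]_n -> R) -> R :=
  match n with
  | 0 => fun f => f 0
  | m.+1 => fun f =>
      \int[lebesgue_measure]_(t in `[(-1 : R), 1])
        cube_integral (fun v : 'rV[R]_m => f (row_mx (t%:M : 'M[R]_1) v))
  end.

Definition kernel_kappa (R : realType) (n : nat) (u : 'rV[R]_n) : R :=
  (2 / pi) ^+ n * \prod_(j < n) Num.sqrt (1 - u ord0 j ^+ 2).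

Definition J_avg (R : realType) (n : nat) (a : R) (J : 'rV[R]_n -> R)
    (x : 'rV[R]_n) : R :=
  cube_integral (fun u => J (x + a *: u) * kernel_kappa u).

Definition dither_S (R : realType) (n : nat) (a : R) (omh : 'rV[R]_n)
    (omega t : R) : 'rV[R]_n :=
  \row_(i < n) (a * sin (omega * omh ord0 i * t)).

Definition dither_M (R : realType) (n : nat) (a : R) (omh : 'rV[R]_n)
    (omega t : R) : 'rV[R]_n :=
  \row_(i < n) (2 ^+ n / a * sin (omega * omh ord0 i * t) *
    \prod_(j < n | j != i) cos (omega * omh ord0 j * t) ^+ 2).

Definition ES_system (R : realType) (n : nat) (J : 'rV[R]_n -> R) (a : R)
    (omh : 'rV[R]_n) (k omega : R) : R -> 'rV[R]_n -> 'rV[R]_n :=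
  fun t x => - (k * J (x + dither_S a omh omega t)) *: dither_M a omh omega t.

Definition ES_field (R : realType) (n : nat) (J : 'rV[R]_n -> R) (a : R)
    (x theta : 'rV[R]_n) : 'rV[R]_n :=
  \row_(i < n) (- (2 ^+ n / a) * J (x + a *: map_mx sin theta) *
    sin (theta ord0 i) * \prod_(j < n | j != i) cos (theta ord0 j) ^+ 2).

Definition ES_slow_system (R : realType) (n : nat) (J : 'rV[R]_n -> R) (a : R)
    (omh : 'rV[R]_n) : R -> 'rV[R]_n -> R -> 'rV[R]_n :=
  fun s x eps => ES_field J a x ((s / eps) *: omh).

(* Main.v *)
(* Idea. In slow time the field is F(x, w s / eps), and by rational independence
   its time averages converge, uniformly in the initial time and for x in compact
   sets, to a field Fbar. Approximate J on boxes by sums of products of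
   one-variable polynomials (Bernstein): then F(x, w t) is a sum of products of
   trigonometric polynomials in the incommensurable phases w_j t, so its average
   is the product of the one-variable averages. With u = sin theta, and an
   integration by parts in the i-th phase, these are the integrals whose product
   is -d_i of the smoothed cost. The estimates being uniform, the averages of F
   itself exist, J_a is differentiable, and Fbar = -grad J_a.

   Classical averaging makes the solutions of the two systems uniformly close on
   bounded time intervals. Finally the KL function beta of the gradient flow
   serves for the extremum seeking system: once beta(Delta, T) is small the
   solution is in a small ball, on which the finite-time comparison is restarted
   every T, and beta(r, 0) is small for small r. *)

(* Two regularity gaps shape the proof. [J] need not be differentiable, and the Lipschitz bound on
   [gradient (J_avg a J)] that averaging requires is not a hypothesis. Both are filled from the time
   averages. The field contains no derivative of the cost, so uniformly close costs have uniformly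
   close fields and hence close averages: the smoothed gradients of the approximating polynomials
   converge on boxes, whatever their own gradients do. Likewise an average inherits the bound and
   the Lipschitz constant of the field.

   Separable polynomials suit both sides, since the time average and the cube integral then factor
   over the coordinates and only one-variable substitutions remain.

   The field is not globally Lipschitz, so solutions are built for its composition with a retraction
   onto a large box. The stability estimate keeps them inside that box, where the retraction does
   nothing, and uniqueness carries the estimate over to every maximal solution.

   Time averages are stated through increments of primitives, so that the estimates in time reduce
   to the mean value inequality. *)
Require Import Defs.
From HB Require Import structures.
From mathcomp Require Import all_boot all_order all_algebra.
From mathcomp Require Import all_classical all_reals all_analysis.
From mathcomp Require Import ring lra.

Set Implicit Arguments.
Unset Strict Implicit.
Unset Printing Implicit Defensive.

Import Order.TTheory GRing.Theory Num.Theory.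
Import numFieldNormedType.Exports.

Local Open Scope classical_set_scope.
Local Open Scope ring_scope.

(** * Vector-valued functions and primitives *)

Section basics.
Context {R : realType}.

Lemma normr_coord n (v : 'rV[R]_n) i : `|v ord0 i| <= `|v|.
Proof.
by rewrite [leRHS]/Num.Def.normr/= mx_normrE; exact: (le_bigmax _ _ (ord0, i)).
Qed.

Lemma normr_rV_le n (v : 'rV[R]_n) c :
  0 <= c -> (forall i, `|v ord0 i| <= c) -> `|v| <= c.
Proof.
move=> c0 vc; rewrite [leLHS]/Num.Def.normr/= mx_normrE.
by apply/bigmax_leP; split => // -[i j] _; rewrite (ord1 i); exact: vc.
Qed.

Lemma cvg_rVP n (T : Type) (F : set_system T) (FF : Filter F)
    (f : T -> 'rV[R]_n) (l : 'rV[R]_n) :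
  (forall i, f x ord0 i @[x --> F] --> l ord0 i) -> f x @[x --> F] --> l.
Proof.
move=> h; apply/cvgrPdist_le => e e0; near=> x.
apply: normr_rV_le (ltW e0) _ => i; rewrite !mxE.
move: i; near: x; apply: filter_forall => i.
exact: (cvgrPdist_le _ _).1 (h i) e e0.
Unshelve. all: by end_near. Qed.

Lemma continuous_rVP n (T : topologicalType) (f : T -> 'rV[R]_n) :
  (forall i, continuous (fun x => f x ord0 i)) -> continuous f.
Proof. by move=> h x; apply: cvg_rVP => i; exact: h. Qed.

Lemma continuous_coord n (T : topologicalType) (f : T -> 'rV[R]_n) i :
  continuous f -> continuous (fun x => f x ord0 i).
Proof.
move=> cf x.
exact: (continuous_comp (cf x) (@coord_continuous R 1 n ord0 i (f x))).
Qed.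

Lemma is_derive_coord n (x : R -> 'rV[R]_n) (t : R) (v : 'rV[R]_n) i :
  is_derive t 1 x v -> is_derive t 1 (fun s => x s ord0 i) (v ord0 i).
Proof.
move=> [dx <-]; apply: DeriveDef; first by move/derivable_mxP: dx; exact.
by rewrite derive_mx// mxE.
Qed.

Lemma is_derive_rV n (x : R -> 'rV[R]_n) (t : R) (v : 'rV[R]_n) :
  (forall i, is_derive t 1 (fun s => x s ord0 i) (v ord0 i)) ->
  is_derive t 1 x v.
Proof.
move=> h.
have dx : derivable x t 1.
  by apply/derivable_mxP => i j; rewrite ord1; exact: ex_derive.
apply: DeriveDef => //; rewrite derive_mx//.
by apply/rowP => j; rewrite mxE; exact: derive_val.
Qed.

Lemma is_derive_continuous (V : normedModType R) (f : R -> V) (t : R) (v : V) :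
  is_derive t 1 f v -> {for t, continuous f}.
Proof. by move=> [+ _]; move/derivable1_diffP/differentiable_continuous. Qed.

(** [G - f] and [G + f] are both nondecreasing. This comparison form of the mean value inequality
    replaces bounds on integrals throughout. *)
Lemma norm_deriv_le (f G : R -> R) (df dG : R -> R) (a b : R) : a <= b ->
  {within `[a, b], continuous f} -> {within `[a, b], continuous G} ->
  (forall x, x \in `]a, b[ -> is_derive x 1 f (df x)) ->
  (forall x, x \in `]a, b[ -> is_derive x 1 G (dG x)) ->
  (forall x, x \in `]a, b[ -> `|df x| <= dG x) ->
  `|f b - f a| <= G b - G a.
Proof.
move=> ab cf cG hf hG h.
have mono (g dg : R -> R) : {within `[a, b], continuous g} ->
    (forall x, x \in `]a, b[ -> is_derive x 1 g (dg x)) ->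
    (forall x, x \in `]a, b[ -> 0 <= dg x) -> g a <= g b.
  move=> cg hg hg0; apply: (@ger0_derive1_ndecr _ g a b) => //.
  - by move=> x /hg [].
  - by move=> x xab; rewrite derive1E; case: (hg x xab) => _ ->; exact: hg0.
have h1 : (G - f) a <= (G - f) b.
  apply: (mono _ (fun x => dG x - df x)).
  - by move=> x; apply: (@continuousB _ _ (subspace `[a, b])); [exact: cG|exact: cf].
  - by move=> x xab; apply: is_deriveB; [exact: hG|exact: hf].
  - by move=> x /h; rewrite ler_norml subr_ge0 => /andP[].
have h2 : (G + f) a <= (G + f) b.
  apply: (mono _ (fun x => dG x + df x)).
  - by move=> x; apply: (@continuousD _ _ (subspace `[a, b])); [exact: cG|exact: cf].
  - by move=> x xab; apply: is_deriveD; [exact: hG|exact: hf].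
  - by move=> x /h; rewrite ler_norml => /andP[+ _]; lra.
by move: h1 h2; rewrite !fctE ler_norml => h1 h2; apply/andP; split; lra.
Qed.

Lemma derive0_eq (f : R -> R) (A : interval R) : 
  (forall x, x \in A -> is_derive x 1 f 0) ->
  forall x y, x \in A -> y \in A -> f x = f y.
Proof.
move=> hf; suff main x y : x \in A -> y \in A -> x <= y -> f x = f y.
  by move=> x y xA yA; case: (leP x y) => [/main->//|/ltW/main->].
move=> xA yA xy.
have sub z : z \in `[x, y] -> z \in A.
  rewrite in_itv/= => /andP[xz zy].
  by apply: (@interval_is_interval _ A x y xA yA); rewrite xz zy.
have : `|f y - f x| <= (0 : R) - 0.
  apply: (@norm_deriv_le f (fun=> 0) (fun=> 0) (fun=> 0) x y xy).
  - apply/continuous_in_subspaceT => z; rewrite inE/= => /sub zA.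
    exact: is_derive_continuous (hf z zA).
  - by apply: continuous_subspaceT => z; exact: cst_continuous.
  - by move=> z zxy; apply: hf; apply: sub; exact: subset_itv_oo_cc.
  - by move=> z _; rewrite normr0.
by rewrite subrr normr_le0 subr_eq0 => /eqP.
Qed.

Lemma is_derive_ext (V : normedModType R) (f g : R -> V) (t : R) (v w : V) :
  f =1 g -> v = w -> is_derive t 1 f v -> is_derive t 1 g w.
Proof. by move=> /funext -> ->. Qed.

Lemma continuous_integrable (f : R -> R) (a b : R) : continuous f ->
  (@lebesgue_measure R).-integrable `[a, b] (EFin \o f).
Proof.
move=> cf; apply: continuous_compact_integrable; first exact: segment_compact.
exact: continuous_subspaceT.
Qed.

Lemma exists_primitive (f : R -> R) : continuous f ->
  exists F : R -> R, forall x : R, is_derive x 1 F (f x).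
Proof.
move=> cf.
pose G (N x : R) := (\int[lebesgue_measure]_(t in `[- N, x]) f t)%R.
have dG (N x : R) : - N < x -> is_derive x 1 (G N) (f x).
  move=> Nx.
  have x1 : x < x + 1 by rewrite ltrDl.
  have [dF F'] := continuous_FTC1_closed x1
    (continuous_integrable (- N) (x + 1) cf) Nx (cf x).
  apply: DeriveDef; first exact: dF.
  by rewrite -[RHS]F' derive1E.
(* The lower endpoint [- N] has to move with [x]. Subtracting the value at 0 makes the primitives
   for different [N] agree, so near [x0] the endpoint can be frozen. *)
exists (fun x => G (`|x| + 1) x - G (`|x| + 1) 0) => x0.
have key (N x : R) : `|x| + 1 <= N ->
    G (`|x| + 1) x - G (`|x| + 1) 0 = G N x - G N 0.
  move=> xN; set M := `|x| + 1.
  have /= := @derive0_eq (G M - G N) `]-M, +oo[ _ x 0.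
  rewrite !fctE => h; apply/eqP; rewrite -subr_eq0; apply/eqP.
  suff : G M x - G N x = G M 0 - G N 0 by lra.
  have x1 := ler_norm (- x); rewrite normrN in x1.
  have x2 := normr_ge0 x.
  apply: h; rewrite ?in_itv/= /M; [|lra|lra].
  move=> y; rewrite in_itv/= andbT => My; rewrite -(subrr (f y)).
  by apply: is_deriveB; apply: dG => //; rewrite /M in xN My *; lra.
have x1 := ler_norm (- x0); rewrite normrN in x1.
have dx0 : is_derive x0 1
    (fun x => G (`|x0| + 2) x - G (`|x0| + 2) 0) (f x0).
  rewrite -[f x0]subr0; apply: is_deriveB; apply: dG; lra.
apply: (near_eq_is_derive _ dx0); near=> x; apply/esym/key.
have : `|x0 - x| <= 1 by near: x; apply: cvgr_dist_le.
by have := ler_normD (x - x0) x0; rewrite subrK (distrC x); lra.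
Unshelve. all: by end_near. Qed.

Lemma continuous_sumE (T : topologicalType) (I : Type) (r : seq I) (P : pred I)
    (F : I -> T -> R) : (forall i, P i -> continuous (F i)) ->
  continuous (fun x => \sum_(i <- r | P i) F i x).
Proof.
move=> h; elim: r => [|i r IH] x.
  by under eq_fun do rewrite big_nil; exact: cvg_cst.
under eq_fun do rewrite big_cons.
case: ifP => [Pi|_]; last exact: IH.
exact: (cvgD (h i Pi x) (IH x)).
Qed.

Lemma continuous_prodE (T : topologicalType) (I : Type) (r : seq I) (P : pred I)
    (F : I -> T -> R) : (forall i, P i -> continuous (F i)) ->
  continuous (fun x => \prod_(i <- r | P i) F i x).
Proof.
move=> h; elim: r => [|i r IH] x.
  by under eq_fun do rewrite big_nil; exact: cvg_cst.
under eq_fun do rewrite big_cons.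
case: ifP => [Pi|_]; last exact: IH.
exact: (cvgM (h i Pi x) (IH x)).
Qed.

Section derive_lambda.
Implicit Types (f g : R -> R) (x a b c : R).

Lemma is_derive_compE f g x a b : is_derive (g x) 1 f a ->
  is_derive x 1 g b -> is_derive x 1 (fun s => f (g s)) (a * b).
Proof. exact: is_derive1_comp. Qed.

Lemma is_derive_mulE f g x a b : is_derive x 1 f a ->
  is_derive x 1 g b -> is_derive x 1 (fun s => f s * g s) (a * g x + f x * b).
Proof.
move=> hf hg; have := is_deriveM hf hg; apply: is_derive_ext => //.
by rewrite /GRing.scale/= addrC (mulrC a).
Qed.

Lemma is_derive_cmulE c f x a : is_derive x 1 f a ->
  is_derive x 1 (fun s => c * f s) (c * a).
Proof. by move=> hf; exact: is_deriveZ. Qed.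

Lemma is_derive_affine b c x : is_derive x 1 (fun s => b * s + c) b.
Proof.
have := is_deriveD (is_derive_cmulE b (is_derive_id x 1)) (is_derive_cst c x 1).
by apply: is_derive_ext => //; rewrite mulr1 addr0.
Qed.

Lemma is_derive_sumE (I : Type) (r : seq I) (F : I -> R -> R) (d : I -> R) x :
  (forall i, is_derive x 1 (F i) (d i)) ->
  is_derive x 1 (fun s => \sum_(i <- r) F i s) (\sum_(i <- r) d i).
Proof.
move=> dF; elim: r => [|i r IH].
  rewrite big_nil; under eq_fun do rewrite big_nil.
  exact: is_derive_cst.
rewrite big_cons; under eq_fun do rewrite big_cons.
exact: is_deriveD (dF i) IH.
Qed.

End derive_lambda.

End basics.

(** * Ordinary differential equations *)

Section ode.
Context {R : realType}.

Lemma norm_deriv_rV_le n (f : R -> 'rV[R]_n) (G : R -> R)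
    (df : R -> 'rV[R]_n) (dG : R -> R) (a b : R) : a <= b ->
  {within `[a, b], continuous f} -> {within `[a, b], continuous G} ->
  (forall x, x \in `]a, b[ -> is_derive x 1 f (df x)) ->
  (forall x, x \in `]a, b[ -> is_derive x 1 G (dG x)) ->
  (forall x, x \in `]a, b[ -> `|df x| <= dG x) ->
  `|f b - f a| <= G b - G a.
Proof.
move=> ab cf cG hf hG h; apply: normr_rV_le.
  (* With [n = 0] no coordinate yields [0 <= G b - G a]; it is the scalar inequality for the zero
     function. *)
  apply: (le_trans (normr_ge0 ((0 : R) - 0))).
  apply: (@norm_deriv_le R (fun=> 0) G (fun=> 0) dG) => //.
  - by apply: continuous_subspaceT => z; exact: cst_continuous.
  - by move=> x /h; apply: le_trans; rewrite normr0.
move=> i; rewrite !mxE.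
apply: (@norm_deriv_le R (fun s => f s ord0 i) G (fun s => df s ord0 i) dG) => //.
- exact: (@continuous_coord R n (subspace `[a, b]) f i cf).
- by move=> x /hf; exact: is_derive_coord.
- by move=> x /h; apply: le_trans; exact: normr_coord.
Qed.

(* The sup norm is not differentiable, hence the sum of squares [v] in the proof
   and the dimension in the exponent. *)
Lemma gronwall n (u du : R -> 'rV[R]_n) (L E t0 t1 : R) :
  0 <= L -> 0 <= E -> t0 <= t1 ->
  {within `[t0, t1], continuous u} ->
  (forall t, t \in `]t0, t1[ -> is_derive t 1 u (du t)) ->
  (forall t, t \in `]t0, t1[ -> `|du t| <= L * (`|u t| + E)) ->
  u t0 = 0 ->
  `|u t1| <= E * expR (3 * n%:R * L * (t1 - t0)).
Proof.
move=> L0 E0 t01 cu hu hdu u0.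
(* With [a] the norm of [u t], [2 * a * (a + E) <= 3 * (a ^+ 2 + E ^+ 2)], so the derivative of [v]
   is at most [K * (v + E ^+ 2)]. The sign in [w] turns this into monotonicity. *)
set K := 3 * n%:R * L.
have K0 : 0 <= K by rewrite /K !mulr_ge0.
pose v t := \sum_(i < n) u t ord0 i ^+ 2.
pose w t := - ((v t + E ^+ 2) * expR (- K * (t - t0))).
have hv t : t \in `]t0, t1[ ->
    is_derive t 1 v (\sum_(i < n) 2 * (u t ord0 i * du t ord0 i)).
  move=> tI; rewrite (_ : v = \sum_(i < n) ((fun s => u s ord0 i) ^+ 2)).
    apply: is_derive_sum => i.
    have := is_derive_coord i (hu t tI) => ?.
    apply: is_derive_eq; rewrite /= expr1 /GRing.scale/= -mulr_natl.
    by ring.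
  by apply/funext => s; rewrite fct_sumE; apply: eq_bigr => i _; rewrite exprfctE.
have he (t : R) : is_derive t 1 (fun s => expR (- K * (s - t0)))
    (- K * expR (- K * (t - t0))).
  rewrite [X in is_derive _ _ _ X]mulrC.
  apply: (@is_derive_compE R expR (fun s => - K * (s - t0)) t _ _
    (is_derive_expR _)).
  apply: is_derive_ext (is_derive_affine (- K) (K * t0) t) => // s.
  by ring.
have hw t : t \in `]t0, t1[ -> is_derive t 1 w
  (- ((\sum_(i < n) 2 * (u t ord0 i * du t ord0 i)) * expR (- K * (t - t0))
   - K * (v t + E ^+ 2) * expR (- K * (t - t0)))).
  move=> tI; have h1 := hv t tI; have h2 := he t.
  apply: is_deriveN.
  have h3 := is_deriveD h1 (is_derive_cst (E ^+ 2) t 1).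
  apply: is_derive_ext (is_derive_mulE h3 h2) => //.
  by rewrite !fctE; ring.
have cv : {within `[t0, t1], continuous v}.
  apply: (@continuous_sumE R (subspace `[t0, t1])) => i _ t.
  have c := @continuous_coord R n (subspace `[t0, t1]) u i cu t.
  exact: (cvgM c c).
have ce : continuous (fun s => expR (- K * (s - t0))).
  by move=> t; exact: is_derive_continuous (he t).
have cw : {within `[t0, t1], continuous w}.
  move=> t; apply: cvgN; apply: cvgM; last first.
    exact: (continuous_subspaceT ce).
  by apply: cvgD; [exact: cv|exact: cvg_cst].
have uv t : `|u t| ^+ 2 <= v t.
  have v0 : 0 <= v t by apply: sumr_ge0 => i _; exact: sqr_ge0.
  rewrite -[leRHS]sqr_sqrtr// lerXn2r ?nnegrE ?sqrtr_ge0//.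
  apply: normr_rV_le; first exact: sqrtr_ge0.
  move=> i; rewrite -sqrtr_sqr; apply: ler_wsqrtr.
  rewrite /v (bigD1 i)//= lerDl.
  by apply: sumr_ge0 => j _; exact: sqr_ge0.
have main : w t0 <= w t1.
  apply: (@ger0_derive1_ndecr _ w t0 t1) => //.
  - by move=> t /hw [].
  - move=> t tI; rewrite derive1E; case: (hw t tI) => _ ->.
    rewrite oppr_ge0 subr_le0; apply: ler_wpM2r; first exact: expR_ge0.
    apply: (@le_trans _ _ (\sum_(i < n) 2 * (`|u t| * (L * (`|u t| + E))))).
      apply: ler_sum => i _; apply: ler_wpM2l => //.
      apply: (le_trans (ler_norm _)); rewrite normrM.
      apply: ler_pM => //; first exact: normr_coord.
      by apply: le_trans (hdu t tI); exact: normr_coord.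
    rewrite sumr_const card_ord -mulr_natl /K.
    have h1 := uv t; set a := `|u t| in h1 *.
    have a0 : 0 <= a by exact: normr_ge0.
    rewrite [leLHS](_ : _ = (n%:R * L) * (2 * a * (a + E))); last by ring.
    rewrite [leRHS](_ : _ = (n%:R * L) * (3 * (v t + E ^+ 2))); last by ring.
    apply: ler_wpM2l; first by rewrite mulr_ge0.
    have := sqr_ge0 (a - E); have := sqr_ge0 E; nra.
move: main; rewrite /w lerN2 subrr mulr0 expR0 mulr1.
have -> : v t0 = 0.
  by rewrite /v big1// => i _; rewrite u0 mxE expr0n.
rewrite add0r mulNr expRN ler_pdivrMr ?expR_gt0// => main.
set e := expR _ in main *.
have e1 : 1 <= e by rewrite -expR0 ler_expR mulr_ge0// subr_ge0.
rewrite -(@ler_pXn2r _ 2) ?nnegrE ?mulr_ge0//; last by apply: le_trans e1.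
apply: (le_trans (uv t1)); rewrite exprMn.
have := sqr_ge0 E; nra.
Qed.

Lemma geometric_le (c e : R) : 0 < e -> exists m, c * 2^-1 ^+ m <= e.
Proof.
move=> e0.
have : (fun m => c * 2^-1 ^+ m) @ \oo --> (0 : R).
  rewrite -(mulr0 c); apply: cvgM; first exact: cvg_cst.
  by apply: cvg_expr; rewrite ger0_norm// invf_lt1// ltr1n.
move/cvgrPdist_le => /(_ e e0) [N _ h]; exists N.
have := h N (leqnn N); rewrite sub0r normrN; apply: le_trans; exact: ler_norm.
Qed.

Lemma geometric_cauchy n (u : nat -> 'rV[R]_n) (c : R) :
  (forall m, `|u m.+1 - u m| <= c * 2^-1 ^+ m) ->
  exists l, forall m, `|u m - l| <= 2 * c * 2^-1 ^+ m.
Proof.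
move=> h.
have c0 : 0 <= c by have := le_trans (normr_ge0 _) (h 0%N); rewrite expr0 mulr1.
have hk m k : `|u (k + m)%N - u m| <= 2 * c * 2^-1 ^+ m * (1 - 2^-1 ^+ k).
  elim: k => [|k IH]; first by rewrite add0n subrr normr0 expr0 subrr mulr0.
  rewrite addSn -(subrKA (u (k + m)%N)).
  apply: (le_trans (ler_normD _ _)); apply: le_trans (lerD (h _) IH) _.
  by rewrite exprD exprS; set a := _ ^+ k; set b := _ ^+ m; lra.
have hk' m k : (m <= k)%N -> `|u k - u m| <= 2 * c * 2^-1 ^+ m.
  move=> mk; rewrite -(subnK mk); apply: (le_trans (hk _ _)).
  have k0 : 0 <= 2^-1 ^+ (k - m) :> R by rewrite exprn_ge0.
  by rewrite ler_piMr ?mulr_ge0 ?exprn_ge0//; lra.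
have : cvg (u @ \oo).
  apply/cauchy_cvgP; apply: cauchy_exP => e e0.
  have [m hm] := @geometric_le (2 * c) (e / 2) (divr_gt0 e0 (ltr0Sn _ 1)).
  exists (u m); exists m => //= k mk; rewrite -ball_normE/=.
  rewrite distrC; apply: (le_lt_trans (hk' _ _ mk)); apply: (le_lt_trans hm).
  by rewrite ltr_pdivrMr// ltr_pMr// ltr1n.
move/cvg_ex => [l ul]; exists l => m.
apply/ler_addgt0Pr => e e0.
have [k [mk ke]] : exists k, (m <= k)%N /\ `|l - u k| <= e.
  have [N _ hN] := (cvgrPdist_le _ _).1 ul e e0.
  exists (maxn m N); split; first exact: leq_maxl.
  by apply: hN; exact: leq_maxr.
rewrite -(subrKA (u k)) (le_trans (ler_normD _ _))// lerD//.
- by rewrite distrC hk'.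
- by rewrite distrC.
Qed.

(** The usual uniform limit argument, where the constant may grow with time, as the weight of the
    Picard iteration does: near [t] it stays below [c t + 1]. *)
Lemma locally_geometric_continuous n (X : nat -> R -> 'rV[R]_n) x (c : R -> R) :
  (forall m, continuous (X m)) -> continuous c ->
  (forall m t, `|X m t - x t| <= c t * 2^-1 ^+ m) -> continuous x.
Proof.
move=> cX cc h t; apply/cvgrPdist_le => e e0.
have [m hm] := @geometric_le (c t + 1) (e / 3) (divr_gt0 e0 (ltr0Sn _ 2)).
have p0 : 0 <= 2^-1 ^+ m :> R by rewrite exprn_ge0.
near=> s.
have h1 : `|X m t - X m s| <= e / 3.
  by near: s; apply: cvgr_dist_le; [exact: cX|rewrite divr_gt0].
have h2 : `|c t - c s| <= 1 by near: s; apply: cvgr_dist_le; [exact: cc|].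
have h3 := h m t; have h4 := h m s.
have h5 : c s <= c t + 1 by move: h2; rewrite ler_norml => /andP[]; lra.
have h6 : c s * 2^-1 ^+ m <= e / 3.
  by apply: le_trans hm; apply: ler_wpM2r.
have h7 : c t * 2^-1 ^+ m <= e / 3.
  by apply: le_trans hm; apply: ler_wpM2r => //; rewrite lerDl.
rewrite distrC in h3.
have := ler_distD (X m t) (x t) (x s).
have := ler_distD (X m s) (X m t) (x s); lra.
Unshelve. all: by end_near. Qed.

Lemma exists_primitive_rV n (f : R -> 'rV[R]_n) : continuous f ->
  exists F : R -> 'rV[R]_n, forall t : R, is_derive t 1 F (f t).
Proof.
move=> cf.
have /choice [F hF] i := exists_primitive (@continuous_coord R n _ f i cf).
exists (fun t => \row_i F i t) => t; apply: is_derive_rV => i.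
by under eq_fun do rewrite mxE; exact: hF.
Qed.

(* Picard iteration, started at the constant [x0]: the weight
   [exp (2 L (t - t0))] makes each step a contraction of ratio 1/2. *)
Lemma exists_solution n (g : R -> 'rV[R]_n -> 'rV[R]_n) (L M t0 : R) x0 :
  0 < L ->
  (forall x, continuous x -> continuous (fun t => g t (x t))) ->
  (forall t x y, `|g t x - g t y| <= L * `|x - y|) ->
  (forall t x, `|g t x| <= M) ->
  exists x : R -> 'rV[R]_n, [/\ x t0 = x0, continuous x &
    forall t, t0 < t -> is_derive t 1 x (g t (x t))].
Proof.
move=> L0 cg Lg Mg.
(* A choice of primitive for every function; its value at a discontinuous function is arbitrary. *)
have [P hP] : exists P : (R -> 'rV[R]_n) -> R -> 'rV[R]_n,
    forall f, continuous f -> forall t : R, is_derive t 1 (P f) (f t).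
  have /choice [P hP] (f : R -> 'rV[R]_n) : exists F : R -> 'rV[R]_n,
      continuous f -> forall t : R, is_derive t 1 F (f t).
    have [/exists_primitive_rV[F hF]|nc] := pselect (continuous f).
      by exists F.
    by exists f.
  by exists P.
have M0 : 0 <= M by apply: le_trans (Mg 0 0).
(* Freezing time at [t0] to the left of [t0] keeps the iterates defined and continuous on the whole
   line. *)
pose up t := Num.max t t0.
have cup : continuous up by move=> t; apply: continuous_max => //; exact: cvg_cst.
pose Phi (x : R -> 'rV[R]_n) t :=
  x0 + (P (fun s => g s (x s)) (up t) - P (fun s => g s (x s)) t0).
have cPhi x : continuous x -> continuous (Phi x).
  move=> cx t; apply: cvgD; first exact: cvg_cst.
  apply: cvgB; last exact: cvg_cst.
  apply: (continuous_comp (cup t)).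
  exact: is_derive_continuous (hP _ (cg x cx) (up t)).
have Phi_le x t : t <= t0 -> Phi x t = x0.
  by move=> tt0; rewrite /Phi /up max_r// subrr addr0.
pose X := fix X m := if m is m'.+1 then Phi (X m') else (fun=> x0).
have cX m : continuous (X m).
  by elim: m => [|m IH]; [move=> t; exact: cvg_cst|exact: cPhi].
pose w t := expR (2 * L * (up t - t0)).
have w_ge0 t : 0 <= w t by exact: expR_ge0.
have cw : continuous w.
  move=> t; apply: continuous_comp; last exact: continuous_expR.
  apply: cvgM; first exact: cvg_cst.
  by apply: cvgB; [exact: cup|exact: cvg_cst].
pose e s := expR (2 * L * (s - t0)).
have he (s : R) : is_derive s 1 e (2 * L * e s).
  rewrite mulrC; apply: (@is_derive_compE R expR (fun s => 2 * L * (s - t0)) s _ _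
    (is_derive_expR _)).
  apply: is_derive_ext (is_derive_affine (2 * L) (- (2 * L * t0)) s) => // r.
  by ring.
have ce : continuous e by move=> s; exact: is_derive_continuous (he s).
have w_up t : t0 <= t -> w t = e t by move=> tt0; rewrite /w /up max_l.
(* The first increment is at most [M * (t - t0)], and [2 * L * (t - t0) <= expR (2 * L * (t -
   t0))]. *)
pose C := M / (2 * L).
have C0 : 0 <= C by rewrite /C divr_ge0// mulr_ge0// ltW.
have step x y c : 0 <= c -> continuous x -> continuous y ->
    (forall t, t0 <= t -> `|x t - y t| <= c * w t) ->
    forall t, `|Phi x t - Phi y t| <= c * 2^-1 * w t.
  move=> c0 cx cy h t.
  have [tt0|tt0] := leP t t0.
    by rewrite !Phi_le// subrr normr0 !mulr_ge0.
  set f := fun s => P (fun s => g s (x s)) s - P (fun s => g s (y s)) s.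
  rewrite (_ : Phi x t - Phi y t = f t - f t0); last first.
    rewrite /Phi /f /up max_l ?ltW//.
    by rewrite opprD addrACA subrr add0r !opprD !opprK addrACA.
  have df (s : R) : is_derive s 1 f (g s (x s) - g s (y s)).
    by apply: is_deriveB; apply: hP; apply: cg.
  have dG (s : R) : is_derive s 1 (fun s => c * 2^-1 * e s)
      (c * 2^-1 * (2 * L * e s)).
    exact: is_derive_cmulE.
  have : `|f t - f t0| <= c * 2^-1 * e t - c * 2^-1 * e t0.
    apply: (@norm_deriv_rV_le n f (fun s => c * 2^-1 * e s)
      (fun s => g s (x s) - g s (y s)) _ t0 t (ltW tt0)) => //.
    - by apply: continuous_subspaceT => s; exact: is_derive_continuous (df s).
    - by apply: continuous_subspaceT => s; exact: is_derive_continuous (dG s).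
    - move=> s; rewrite in_itv/= => /andP[/ltW ts _].
      apply: (le_trans (Lg _ _ _)).
      rewrite (_ : c * _ * _ = L * (c * e s)); last by field.
      by rewrite ler_pM2l// -w_up// h.
  rewrite w_up ?(ltW tt0)//; move=> /le_trans; apply.
  by rewrite gerBl; apply: mulr_ge0; [exact: divr_ge0|exact: expR_ge0].
have hX m t : `|X m.+1 t - X m t| <= (C * w t) * 2^-1 ^+ m.
  rewrite mulrAC; elim: m t => [|m IH] t; last first.
    rewrite exprSr mulrA; apply: (step _ _ _ _ (cX _) (cX _) (fun t _ => IH t)).
    by apply: mulr_ge0 => //; exact: exprn_ge0.
  rewrite expr0 mulr1.
  have [tt0|tt0] := leP t t0.
    by rewrite /= Phi_le// subrr normr0 mulr_ge0.
  have dP (s : R) : is_derive s 1 (P (fun r => g r x0)) (g s x0).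
    by apply: hP; apply: (cg (fun=> x0)) => r; exact: cvg_cst.
  set f := P _ in dP.
  have -> : X 1%N t - X 0%N t = f t - f t0.
    by rewrite /= /Phi /up max_l ?ltW// addrAC subrr add0r.
  apply: (@le_trans _ _ (M * t - M * t0)).
    apply: (@norm_deriv_rV_le n f (fun s => M * s) _ (fun=> M) t0 t (ltW tt0)).
    - by apply: continuous_subspaceT => s; exact: is_derive_continuous (dP s).
    - by apply: continuous_subspaceT => s; apply: cvgM; [exact: cvg_cst|].
    - by move=> s _; have := is_derive_affine M 0 s; under eq_fun do rewrite addr0.
    - by move=> s _; exact: Mg.
  rewrite w_up ?(ltW tt0)// /e /C.
  have := expR_ge1Dx (2 * L * (t - t0)); set E := expR _ => hE.
  rewrite mulrAC ler_pdivlMr ?mulr_gt0//.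
  nra.
have /choice [x hx] t : exists l, forall m,
    `|X m t - l| <= 2 * (C * w t) * 2^-1 ^+ m.
  by apply: geometric_cauchy => m; exact: hX.
have cx : continuous x.
  apply: (locally_geometric_continuous cX _ (fun m t => hx t m)).
  by move=> t; do 2 (apply: cvgM; [exact: cvg_cst|]); exact: cw.
have xPhi t : x t = Phi x t.
  apply/eqP; rewrite -subr_eq0 -normr_le0; apply/ler_addgt0Pr => d d0.
  rewrite add0r.
  have [m hm] := @geometric_le (2 * C * w t) d d0.
  have h1 := hx t m.+1.
  have h2 : `|X m.+1 t - Phi x t| <= 2 * C * 2^-1 ^+ m * 2^-1 * w t.
    apply: (step _ _ _ _ (cX m) cx) => [|s _].
      by apply: mulr_ge0; [exact: mulr_ge0|exact: exprn_ge0].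
    by apply: (le_trans (hx s m)); rewrite mulrA mulrAC.
  apply: le_trans hm.
  have := ler_distD (X m.+1 t) (x t) (Phi x t).
  rewrite distrC exprS in h1; set p := _ ^+ m in h1 h2 *; lra.
exists x; split => //; first by rewrite xPhi Phi_le.
move=> t tt0.
have dx : is_derive t 1
    (fun t => x0 + (P (fun s => g s (x s)) t - P (fun s => g s (x s)) t0))
    (g t (x t)).
  rewrite -[g t (x t)]add0r -[X in 0 + X]subr0.
  apply: is_deriveD; apply: is_deriveB; apply: hP; exact: cg.
apply: (near_eq_is_derive _ dx); near=> s.
have st0 : t0 < s by near: s; exact: lt_nbhsr.
by rewrite [RHS]xPhi /Phi /up max_l// ltW.
Unshelve. all: by end_near. Qed.

End ode.

(** * Uniqueness and maximal solutions *)

Section uniqueness.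
Context {R : realType} {n : nat}.
Implicit Types (g : R -> 'rV[R]_n -> 'rV[R]_n)
  (t : R) (T : \bar R).

Definition lipschitz_on_balls g := forall B, exists2 L, 0 <= L &
  forall t u v, `|u| <= B -> `|v| <= B -> `|g t u - g t v| <= L * `|u - v|.

Lemma segment_bounded (x : R -> 'rV[R]_n) (a b : R) : a <= b ->
  {within `[a, b], continuous x} ->
  exists B, forall t, t \in `[a, b] -> `|x t| <= B.
Proof.
move=> ab cx.
have [c _ hc] : exists2 c, c \in `[a, b] & forall t, t \in `[a, b] ->
    `|x t| <= `|x c|.
  apply: (@EVT_max R (fun t => `|x t|)) => // t.
  exact: (cvg_norm (cx t)).
by exists `|x c|.
Qed.

Lemma is_solution_within g (t0 t1 : R) x0 T x : is_solution g t0 x0 T x ->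
  (t1%:E < T)%E -> {within `[t0, t1], continuous x}.
Proof.
move=> [_ _ cx _] t1T; apply: continuous_subspaceW cx => t /=.
rewrite in_itv/= => /andP[t0t tt1]; split => //.
by apply: le_lt_trans t1T; rewrite lee_fin.
Qed.

(** Gronwall's inequality with [E = 0]: on the segment up to [t1] both solutions are bounded, so a
    single Lipschitz constant serves. *)
Lemma solution_unique g t0 x0 T1 T2 x y : lipschitz_on_balls g ->
  is_solution g t0 x0 T1 x -> is_solution g t0 x0 T2 y ->
  forall t, t0 <= t -> (t%:E < T1)%E -> (t%:E < T2)%E -> x t = y t.
Proof.
move=> Lg sx sy t1 t01 t1T1 t1T2.
have cx := is_solution_within sx t1T1.
have cy := is_solution_within sy t1T2.
have [B1 hB1] := segment_bounded t01 cx.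
have [B2 hB2] := segment_bounded t01 cy.
have [L L0 hL] := Lg (Num.max B1 B2).
have [_ x0E _ dx] := sx.
have [_ y0E _ dy] := sy.
have sub t : t \in `]t0, t1[ -> [/\ t0 < t, (t%:E < T1)%E & (t%:E < T2)%E].
  rewrite in_itv/= => /andP[tt0 tt1]; split => //.
  - by apply: le_lt_trans t1T1; rewrite lee_fin ltW.
  - by apply: le_lt_trans t1T2; rewrite lee_fin ltW.
have := @gronwall R n (x - y) (fun t => g t (x t) - g t (y t)) L 0 t0 t1 L0
  (lexx 0) t01.
rewrite mul0r normr_le0 => h; apply/eqP; rewrite -subr_eq0; apply: h.
- exact: within_continuousB cx cy.
- by move=> t /sub [? ? ?]; apply: is_deriveB; [exact: dx|exact: dy].
- move=> t tI; rewrite addr0; apply: hL.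
  + by rewrite le_max hB1//; exact: subset_itv_oo_cc.
  + by rewrite le_max hB2 ?orbT//; exact: subset_itv_oo_cc.
- by rewrite !fctE x0E y0E subrr.
Qed.

(** One global solution settles all maximal ones: they agree with it by uniqueness, and if one ended
    at a finite time it would be continued by the global one. *)
Lemma global_solution_with g t0 (x0 : 'rV[R]_n) x (P : R -> 'rV[R]_n -> Prop) :
  lipschitz_on_balls g -> is_solution g t0 x0 +oo%E x ->
  (forall t, t0 <= t -> P t (x t)) -> solutions_global_with g t0 x0 P.
Proof.
move=> Lg sx Px; split.
  exists +oo%E, x; split => // T' y; by rewrite ltNge leey.
move=> T y [sy maxy].
have yx t : t0 <= t -> (t%:E < T)%E -> x t = y t.
  by move=> tt0 tT; apply: (solution_unique Lg sx sy) => //; rewrite ltry.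
have TE : T = +oo%E.
  apply/eqP; apply: contrapT => /negP TN.
  have Tlt : (T < +oo)%E by rewrite lt_neqAle TN leey.
  exact: maxy _ _ Tlt sx yx.
split => // t tt0; rewrite -yx//; first exact: Px.
by rewrite TE ltry.
Qed.

End uniqueness.

(** * Mean values in time *)

Section mean_value.
Context {R : realType} {X : Type}.
Implicit Types (f g : X -> R -> R) (m c : X -> R).

(** The average of [f x] over [[t0, t0 + T]] tends to [m x], uniformly in [t0] and in the parameter
    [x]. Uniformity over a box is obtained by taking the box itself as the type [X]. *)
Definition mean_value f m := exists2 Phi : X -> R -> R,
  (forall x (t : R), is_derive t 1 (Phi x) (f x t)) &
  forall eta, 0 < eta -> exists2 T0, 0 < T0 & forall x t0 T, T0 <= T ->
    `|Phi x (t0 + T) - Phi x t0 - T * m x| <= eta * T.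

Definition bounded_coef c := exists C, forall x, `|c x| <= C.

Lemma bounded_coefM c c' : bounded_coef c -> bounded_coef c' ->
  bounded_coef (fun x => c x * c' x).
Proof.
move=> [C hC] [C' hC']; exists (C * C') => x.
by rewrite normrM ler_pM.
Qed.

Lemma bounded_coef_cst (r : R) : bounded_coef (fun=> r).
Proof. by exists `|r|. Qed.

Lemma mean_value_ext f g m m' : mean_value f m ->
  (forall x t, f x t = g x t) -> (forall x, m x = m' x) -> mean_value g m'.
Proof.
move=> + fg mm.
have <- : f = g by apply/funext => x; apply/funext => t; exact: fg.
by have <- : m = m' by exact/funext.
Qed.

Lemma mean_value_cst c : mean_value (fun x _ => c x) c.
Proof.
exists (fun x t => c x * t).
  move=> x t; have := is_derive_affine (c x) 0 t.
  by under eq_fun do rewrite addr0.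
move=> eta eta0; exists 1 => // x t0 T T1.
rewrite (_ : _ - _ - _ = 0); last by ring.
by rewrite normr0 mulr_ge0 ?ltW// (lt_le_trans _ T1).
Qed.

(** The primitive oscillates with amplitude [1 / |nu|], so its increments are at most [2 / |nu|],
    which is below [eta * T] as soon as [T >= 2 / (|nu| * eta)]. *)
Lemma mean_value_cos (nu phi : R) : nu != 0 ->
  mean_value (fun _ t => cos (nu * t + phi)) (fun=> 0).
Proof.
move=> nu0.
exists (fun _ t => nu^-1 * sin (nu * t + phi)).
  move=> x t; rewrite -[cos _](mulKf nu0); apply: is_derive_cmulE.
  rewrite mulrC; apply: (@is_derive_compE R sin (fun s => nu * s + phi) t _ _
    (is_derive_sin _)); exact: is_derive_affine.
move=> eta eta0; have nn : 0 < `|nu| by rewrite normr_gt0.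
exists (2 / (`|nu| * eta)); first by rewrite divr_gt0// mulr_gt0.
move=> _ t0 T; rewrite ler_pdivrMr ?mulr_gt0// => hT.
rewrite mulr0 subr0 -mulrBr normrM normfV ler_pdivrMl//.
have := ler_normB (sin (nu * (t0 + T) + phi)) (sin (nu * t0 + phi)).
have := sin_max (nu * (t0 + T) + phi); have := sin_max (nu * t0 + phi).
by rewrite (mulrC eta) mulrCA; lra.
Qed.

Lemma mean_valueD f g m m' : mean_value f m -> mean_value g m' ->
  mean_value (fun x t => f x t + g x t) (fun x => m x + m' x).
Proof.
move=> [F dF hF] [G dG hG]; exists (fun x t => F x t + G x t).
  by move=> x t; exact: is_deriveD (dF x t) (dG x t).
move=> eta eta0.
have e2 : 0 < eta / 2 by rewrite divr_gt0.
have [T1 T10 h1] := hF _ e2; have [T2 T20 h2] := hG _ e2.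
exists (Num.max T1 T2); first by rewrite lt_max T10.
move=> x t0 T; rewrite ge_max => /andP[hT1 hT2].
rewrite (_ : _ - _ - _ = (F x (t0 + T) - F x t0 - T * m x) +
  (G x (t0 + T) - G x t0 - T * m' x)); last by ring.
apply: (le_trans (ler_normD _ _)).
by have := h1 x t0 T hT1; have := h2 x t0 T hT2; lra.
Qed.

Lemma mean_valueZ c f m : bounded_coef c -> mean_value f m ->
  mean_value (fun x t => c x * f x t) (fun x => c x * m x).
Proof.
move=> [C hC] [F dF hF]; exists (fun x t => c x * F x t).
  by move=> x t; exact: is_derive_cmulE (dF x t).
move=> eta eta0; have C1 : 0 < `|C| + 1 by rewrite ltr_wpDl.
have [T1 T10 h1] := hF _ (divr_gt0 eta0 C1).
exists T1 => // x t0 T hT.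
rewrite (_ : _ - _ - _ = c x * (F x (t0 + T) - F x t0 - T * m x)); last by ring.
rewrite normrM; have := h1 x t0 T hT; rewrite mulrAC ler_pdivlMr// => h.
apply: le_trans h; rewrite mulrC; apply: ler_wpM2l => //.
by apply: (le_trans (hC x)); apply: (le_trans (ler_norm C)); rewrite lerDl.
Qed.

Lemma mean_value_sum (I : Type) (r : seq I) (F : I -> X -> R -> R)
    (M : I -> X -> R) : (forall i, mean_value (F i) (M i)) ->
  mean_value (fun x t => \sum_(i <- r) F i x t) (fun x => \sum_(i <- r) M i x).
Proof.
move=> h; elim: r => [|i r IH].
  by apply: mean_value_ext (mean_value_cst (fun=> 0)) _ _ => *; rewrite big_nil.
by apply: mean_value_ext (mean_valueD (h i) IH) _ _ => *; rewrite big_cons.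
Qed.

Lemma primitive_diff_le (f g F G : R -> R) (c t T : R) : 0 <= T ->
  (forall t : R, is_derive t 1 F (f t)) -> (forall t : R, is_derive t 1 G (g t)) ->
  (forall t, `|f t - g t| <= c) ->
  `|(F (t + T) - F t) - (G (t + T) - G t)| <= c * T.
Proof.
move=> T0 dF dG h.
have dH (s : R) : is_derive s 1 (fun s => c * s) c.
  by have := is_derive_affine c 0 s; under eq_fun do rewrite addr0.
rewrite (_ : _ - _ = (F - G) (t + T) - (F - G) t); last by rewrite !fctE; ring.
rewrite (_ : c * T = c * (t + T) - c * t); last by ring.
apply: (@norm_deriv_le R (F - G) (fun s => c * s) (fun s => f s - g s)
  (fun=> c) t (t + T) _ _ _ (fun s _ => is_deriveB (dF s) (dG s))
  (fun s _ => dH s)).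
- by rewrite lerDl.
- apply: continuous_subspaceT => s.
  exact: is_derive_continuous (is_deriveB (dF s) (dG s)).
- by apply: continuous_subspaceT => s; exact: is_derive_continuous (dH s).
- by move=> s _; exact: h.
Qed.

(** Over a long time [T] the increments of the two primitives differ by at most [r * T]. All bounds
    on averaged fields are drawn from here. *)
Lemma mean_value_le f g m m' x (r : R) : mean_value f m -> mean_value g m' ->
  (forall t, `|f x t - g x t| <= r) -> `|m x - m' x| <= r.
Proof.
move=> [F dF hF] [G dG hG] h; apply/ler_addgt0Pr => eta eta0.
have e2 : 0 < eta / 2 by rewrite divr_gt0.
have [T1 T10 h1] := hF _ e2; have [T2 T20 h2] := hG _ e2.
set T := Num.max T1 T2.
have T0 : 0 < T by rewrite lt_max T10.
have := h1 x 0 T; rewrite le_max lexx => /(_ isT) {}h1.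
have := h2 x 0 T; rewrite le_max lexx orbT => /(_ isT) {}h2.
have h3 := primitive_diff_le 0 (ltW T0) (dF x) (dG x) h.
rewrite -(ler_pM2l T0) -[X in X * `|_|](gtr0_norm T0) -normrM.
rewrite (_ : T * (m x - m' x) =
  ((F x (0 + T) - F x 0) - (G x (0 + T) - G x 0)) -
  (F x (0 + T) - F x 0 - T * m x) + (G x (0 + T) - G x 0 - T * m' x)); last by ring.
apply: (le_trans (ler_normD _ _)).
set A := _ - _ - (G x _ - _) in h3 *; set B := _ - T * m x in h1 *.
have := ler_normB A B; lra.
Qed.

Lemma mean_value_limit f m : (forall x, continuous (f x)) ->
  (forall eta, 0 < eta -> exists g m', [/\ mean_value g m',
    forall x t, `|f x t - g x t| <= eta & forall x, `|m x - m' x| <= eta]) ->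
  mean_value f m.
Proof.
move=> cf h.
have /choice [F dF] x := exists_primitive (cf x).
exists F => // eta eta0.
have e3 : 0 < eta / 3 by rewrite divr_gt0.
have [g [m' [[G dG hG] fg mm']]] := h _ e3.
have [T1 T10 h1] := hG _ e3; exists T1 => // x t0 T hT.
have {}h1 := h1 x t0 T hT.
have T0 : 0 <= T by apply: le_trans hT; exact: ltW.
have h2 := primitive_diff_le t0 T0 (dF x) (dG x) (fg x).
have h3 : `|T * (m' x - m x)| <= eta / 3 * T.
  rewrite normrM ger0_norm// mulrC; apply: ler_wpM2r => //.
  by rewrite distrC; exact: mm'.
set A := _ - _ - (G x _ - _) in h2; set B := _ - T * m' x in h1.
set D := T * _ in h3.
rewrite (_ : _ - _ - _ = A + B + D); last by rewrite /A /B /D; ring.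
have := ler_normD (A + B) D; have := ler_normD A B; lra.
Qed.

End mean_value.

(** With [Y] the one-point type, the values of one function at two parameters become two functions
    of the same parameter, the form in which [mean_value_le] compares them. *)
Lemma mean_value_comp {R : realType} (X Y : Type) (phi : Y -> X) (f : X -> R -> R) m :
  mean_value f m -> mean_value (fun y => f (phi y)) (fun y => m (phi y)).
Proof.
move=> [F dF hF]; exists (fun y => F (phi y)) => // eta /hF[T0 T00 h].
by exists T0 => // y; exact: h.
Qed.

Section trigpoly.
Context {R : realType} {X : Type}.

Lemma cosM (u v : R) : cos u * cos v = 2^-1 * (cos (u + v) + cos (u - v)).
Proof. by rewrite cosD cosB; field. Qed.

(** The second index is the mean over a period. The phase [phi] accounts for sines. The coefficients
    depend on the parameter, later the state, and their boundedness keeps the averages uniform in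
    it. *)
Inductive trigpoly : (X -> R -> R) -> (X -> R) -> Prop :=
| Trigpoly_cst c : bounded_coef c -> trigpoly (fun x _ => c x) c
| Trigpoly_cos c k phi : bounded_coef c -> (0 < k)%N ->
    trigpoly (fun x t => c x * cos (k%:R * t + phi)) (fun=> 0)
| TrigpolyD f m g m' : trigpoly f m -> trigpoly g m' ->
    trigpoly (fun x t => f x t + g x t) (fun x => m x + m' x).

Lemma trigpoly_ext f g m m' : trigpoly f m ->
  (forall x t, f x t = g x t) -> (forall x, m x = m' x) -> trigpoly g m'.
Proof.
move=> + fg mm.
have <- : f = g by apply/funext => x; apply/funext => t; exact: fg.
by have <- : m = m' by exact/funext.
Qed.

Lemma trigpolyZ c f m : bounded_coef c -> trigpoly f m ->
  trigpoly (fun x t => c x * f x t) (fun x => c x * m x).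
Proof.
move=> bc; elim => [d bd|d k phi bd k0|{}f {}m g m' _ IHf _ IHg].
- exact: Trigpoly_cst (bounded_coefM bc bd).
- by apply: trigpoly_ext (Trigpoly_cos phi (bounded_coefM bc bd) k0) _ _ => *;
    rewrite ?mulrA ?mulr0.
- by apply: trigpoly_ext (TrigpolyD IHf IHg) _ _ => *; rewrite mulrDr.
Qed.

Lemma trigpoly_cosn c (k : nat) phi : bounded_coef c ->
  exists m, trigpoly (fun x t => c x * cos (k%:R * t + phi)) m.
Proof.
move=> bc; case: (posnP k) => [->|k0]; last by exists (fun=> 0); exact: Trigpoly_cos.
exists (fun x => c x * cos phi).
apply: trigpoly_ext
  (Trigpoly_cst (bounded_coefM bc (bounded_coef_cst (cos phi)))) _ _ => // x t.
by rewrite mul0r add0r.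
Qed.

(** The product formula produces the frequencies [k + l] and [|k - l|]. Equal frequencies leave a
    constant depending on the phases, so the mean is only claimed to exist; [trigpoly_primitive]
    serves to compute it afterwards. *)
Lemma trigpolyM_cos c k phi f m : bounded_coef c -> trigpoly f m ->
  exists m', trigpoly (fun x t => c x * cos (k%:R * t + phi) * f x t) m'.
Proof.
move=> bc; elim => [d bd|d l psi bd l0|{}f {}m g m' _ [m1 IHf] _ [m2 IHg]].
- have [m' h] := trigpoly_cosn k phi (bounded_coefM bc bd).
  by exists m'; apply: trigpoly_ext h _ _ => // x t; ring.
- have be : bounded_coef (fun x : X => 2^-1 * (c x * d x)).
    exact: bounded_coefM (bounded_coef_cst 2^-1) (bounded_coefM bc bd).
  have [m1 h1] := trigpoly_cosn (k + l) (phi + psi) be.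
  have [lk|/ltnW kl] := leqP l k.
    have [m2 h2] := trigpoly_cosn (k - l) (phi - psi) be.
    exists (fun x => m1 x + m2 x); apply: trigpoly_ext (TrigpolyD h1 h2) _ _ => // x t.
    rewrite (_ : _ * _ * _ =
      c x * d x * (cos (k%:R * t + phi) * cos (l%:R * t + psi))); last by ring.
    rewrite cosM natrD natrB//.
    rewrite (_ : _ + (l%:R * _ + _) = (k%:R + l%:R) * t + (phi + psi)); last by ring.
    rewrite (_ : _ - (l%:R * _ + _) = (k%:R - l%:R) * t + (phi - psi)); last by ring.
    by ring.
  have [m2 h2] := trigpoly_cosn (l - k) (psi - phi) be.
  exists (fun x => m1 x + m2 x); apply: trigpoly_ext (TrigpolyD h1 h2) _ _ => // x t.
  rewrite (_ : _ * _ * _ =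
      c x * d x * (cos (k%:R * t + phi) * cos (l%:R * t + psi))); last by ring.
  rewrite cosM natrD natrB// -(cosN (_ - (l%:R * _ + _))).
  rewrite (_ : _ + (l%:R * _ + _) = (k%:R + l%:R) * t + (phi + psi)); last by ring.
  rewrite (_ : - (_ - (l%:R * _ + _)) = (l%:R - k%:R) * t + (psi - phi)); last by ring.
  by ring.
- exists (fun x => m1 x + m2 x); apply: trigpoly_ext (TrigpolyD IHf IHg) _ _ => // x t.
  by rewrite mulrDr.
Qed.

Lemma trigpolyM f m g m' : trigpoly f m -> trigpoly g m' ->
  exists m'', trigpoly (fun x t => f x t * g x t) m''.
Proof.
move=> + hg; elim => [d bd|d l psi bd l0|{}f {}m f' m1' _ [m1 IHf] _ [m2 IHg]].
- by eexists; exact: trigpolyZ hg.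
- exact: trigpolyM_cos hg.
- exists (fun x => m1 x + m2 x); apply: trigpoly_ext (TrigpolyD IHf IHg) _ _ => // x t.
  by rewrite mulrDl.
Qed.

Lemma trigpoly_sin : trigpoly (fun _ => sin) (fun=> 0).
Proof.
apply: trigpoly_ext
  (Trigpoly_cos (- (pi / 2)) (bounded_coef_cst 1) (ltn0Sn 0)) _ _ => // x t.
by rewrite !mul1r cosBpihalf.
Qed.

Lemma trigpoly_cos : trigpoly (fun _ => cos) (fun=> 0).
Proof.
apply: trigpoly_ext (Trigpoly_cos 0 (bounded_coef_cst 1) (ltn0Sn 0)) _ _ => // x t.
by rewrite !mul1r addr0.
Qed.

Lemma trigpoly_horner (xi : X -> R) (a : R) (p : {poly R}) : bounded_coef xi ->
  exists m, trigpoly (fun x t => p.[xi x + a * sin t]) m.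
Proof.
move=> bxi; elim/poly_ind: p => [|p c [m IH]].
  exists (fun=> 0); apply: trigpoly_ext (Trigpoly_cst (bounded_coef_cst 0)) _ _ => // x t.
  by rewrite horner0.
have h := TrigpolyD (Trigpoly_cst bxi) (trigpolyZ (bounded_coef_cst a) trigpoly_sin).
have [m1 h1] := trigpolyM IH h.
eexists; apply: trigpoly_ext (TrigpolyD h1 (Trigpoly_cst (bounded_coef_cst c))) _ _.
  by move=> x t; rewrite hornerMXaddC.
by [].
Qed.

(** The increment over one period determines [m x], so a mean obtained by mere existence can be
    evaluated by one-variable calculus. *)
Lemma trigpoly_primitive f m x : trigpoly f m ->
  exists2 K : R -> R, forall t : R, is_derive t 1 K (f x t) &
    forall t, K (t + pi *+ 2) - K t = pi *+ 2 * m x.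
Proof.
elim => [d bd|d l psi bd l0|{}f {}m g m' _ [F dF hF] _ [G dG hG]].
- exists (fun t => d x * t) => [t|t]; last by ring.
  by have := is_derive_affine (d x) 0 t; under eq_fun do rewrite addr0.
- have l1 : l%:R != 0 :> R by rewrite pnatr_eq0 -lt0n.
  exists (fun t => d x * (l%:R^-1 * sin (l%:R * t + psi))) => t.
    apply: is_derive_cmulE; rewrite -[cos _](mulKf l1); apply: is_derive_cmulE.
    rewrite mulrC; apply: (@is_derive_compE R sin (fun s => l%:R * s + psi) t _ _
      (is_derive_sin _)); exact: is_derive_affine.
  rewrite mulr0; apply/eqP; rewrite subr_eq0; apply/eqP; congr (_ * (_ * _)).
  rewrite mulrDr addrAC (mulr_natl (pi *+ 2)).
  by rewrite (periodicn (@sinD2pi R)).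
- exists (fun t => F t + G t) => t; first exact: is_deriveD.
  by rewrite (mulrDr (pi *+ 2)) -(hF t) -(hG t); ring.
Qed.

End trigpoly.

(** * Products of trigonometric polynomials with incommensurable frequencies *)

Section incommensurable.
Context {R : realType} {n : nat} (w : 'rV[R]_n).
Hypothesis w_indep : rationally_independent w.

Definition frequency (l : 'rV[int]_n) : R := \sum_i (l ord0 i)%:~R * w ord0 i.

Lemma frequency_neq0 l : l != 0 -> frequency l != 0.
Proof.
move=> l0; have := @w_indep (map_mx intr l).
have -> : \sum_(i < n) ratr (map_mx intr l ord0 i) * w ord0 i = frequency l.
  by apply: eq_bigr => i _; rewrite mxE ratr_int.
apply; apply: contra l0 => /eqP/rowP h; apply/eqP/rowP => i.
by have := h i; rewrite !mxE => /eqP; rewrite intr_eq0 => /eqP.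
Qed.

Lemma frequency0 : frequency 0 = 0.
Proof. by rewrite /frequency big1// => i _; rewrite mxE mul0r. Qed.

Lemma frequencyD l l' : frequency (l + l') = frequency l + frequency l'.
Proof.
rewrite -big_split; apply: eq_bigr => i _ /=.
by rewrite mxE intrD mulrDl.
Qed.

Lemma frequency_delta k j : frequency (k *: delta_mx ord0 j) = k%:~R * w ord0 j.
Proof.
rewrite /frequency (bigD1 j)//= big1 ?addr0.
  by rewrite !mxE !eqxx mulr1.
by move=> i /negPf ij; rewrite !mxE ij andbF mulr0 mul0r.
Qed.

(* The factor [cos (frequency l * t + phi)] makes the induction on the list of
   coordinates go through: each product of cosines only shifts [l]. *)
Lemma mean_value_prod_cos (X : Type) (F : 'I_n -> X -> R -> R) (m : 'I_n -> X -> R)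
    (js : seq 'I_n) (l : 'rV[int]_n) (phi : R) :
  (forall j, trigpoly (F j) (m j)) -> uniq js ->
  (forall j, j \in js -> l ord0 j = 0) ->
  mean_value (fun x t => (\prod_(j <- js) F j x (w ord0 j * t)) *
      cos (frequency l * t + phi))
    (fun x => (\prod_(j <- js) m j x) * (if l == 0 then cos phi else 0)).
Proof.
move=> hF; elim: js l phi => [|j js IH] l phi.
  move=> _ _; have [->|l0] := eqVneq l 0.
    apply: mean_value_ext (mean_value_cst (fun=> cos phi)) _ _ => [x t|x].
      by rewrite big_nil frequency0 mul0r add0r mul1r.
    by rewrite big_nil mul1r.
  apply: mean_value_ext (mean_value_cos phi (frequency_neq0 l0)) _ _ => *.
    by rewrite big_nil mul1r.
  by rewrite mulr0.
move=> /= /andP[jjs ujs] hl.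
have lj : l ord0 j = 0 by apply: hl; rewrite inE eqxx.
(* Coordinate [j] of [l] is still zero, so adding [k != 0] there gives a nonzero multi-index: by
   independence its frequency is nonzero and the mean vanishes. *)
have shift (k : int) psi : k != 0 ->
    mean_value (fun x t => (\prod_(i <- js) F i x (w ord0 i * t)) *
      cos ((frequency l + k%:~R * w ord0 j) * t + psi)) (fun=> 0).
  move=> k0; rewrite -frequency_delta -frequencyD.
  have lk0 : l + k *: delta_mx ord0 j != 0.
    apply: contra k0 => /eqP/rowP/(_ j).
    by rewrite !mxE lj !eqxx mulr1 add0r => ->.
  apply: mean_value_ext (IH (l + k *: delta_mx ord0 j) psi ujs _) _ _ => //.
    move=> i ijs; rewrite !mxE hl ?inE ?ijs ?orbT//.
    have /negPf -> : i != j by apply: contraNneq jjs => <-.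
    by rewrite andbF mulr0 addr0.
  by move=> x; rewrite (negPf lk0) mulr0.
suff main f mf : trigpoly f mf -> mean_value
    (fun x t => f x (w ord0 j * t) * ((\prod_(i <- js) F i x (w ord0 i * t)) *
      cos (frequency l * t + phi)))
    (fun x => mf x * ((\prod_(i <- js) m i x) * (if l == 0 then cos phi else 0))).
  apply: mean_value_ext (main _ _ (hF j)) _ _ => *;
    by rewrite big_cons !mulrA.
have {}IH : mean_value
    (fun x t => (\prod_(i <- js) F i x (w ord0 i * t)) *
      cos (frequency l * t + phi))
    (fun x => (\prod_(i <- js) m i x) * (if l == 0 then cos phi else 0)).
  by apply: IH => // i ijs; apply: hl; rewrite inE ijs orbT.
elim => [c bc|c k psi bc k0|{}f {}mf g mg _ IHf _ IHg].
- exact: mean_valueZ bc IH.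
- have k1 : k%:Z != 0 by case: k k0.
  have k2 : - k%:Z != 0 by rewrite oppr_eq0.
  have bc2 := bounded_coefM (bounded_coef_cst 2^-1) bc.
  have h := mean_valueD (shift _ (phi + psi) k1) (shift _ (phi - psi) k2).
  apply: mean_value_ext (mean_valueZ bc2 h) _ _ => [x t|x]; last first.
    by rewrite addr0 mulr0 mul0r.
  set P := \prod_(i <- js) _.
  rewrite (_ : c x * cos (k%:R * (w ord0 j * t) + psi) *
    (P * cos (frequency l * t + phi)) =
    c x * P * (cos (frequency l * t + phi) * cos (k%:R * (w ord0 j * t) + psi)));
    last by ring.
  rewrite cosM -mulrDr intrN -pmulrn.
  rewrite (_ : frequency l * t + phi + _ =
    (frequency l + k%:R * w ord0 j) * t + (phi + psi)); last by ring.
  rewrite (_ : frequency l * t + phi - _ =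
    (frequency l + - k%:R * w ord0 j) * t + (phi - psi)); last by ring.
  by ring.
- by apply: mean_value_ext (mean_valueD IHf IHg) _ _ => *; rewrite mulrDl.
Qed.

Lemma mean_value_prod (X : Type) (F : 'I_n -> X -> R -> R) (m : 'I_n -> X -> R) :
  (forall j, trigpoly (F j) (m j)) ->
  mean_value (fun x t => \prod_j F j x (w ord0 j * t)) (fun x => \prod_j m j x).
Proof.
move=> hF.
have l0 j : j \in index_enum 'I_n -> (0 : 'rV[int]_n) ord0 j = 0.
  by rewrite mxE.
apply: mean_value_ext (mean_value_prod_cos 0 hF (index_enum_uniq _) l0) _ _.
- by move=> x t; rewrite frequency0 mul0r add0r cos0 mulr1.
- by move=> x; rewrite eqxx cos0 mulr1.
Qed.

End incommensurable.

(** * Means over a period as integrals against the semicircle density *)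

Section semicircle.
Context {R : realType}.
Implicit Types (p : {poly R}) (a x : R).

(** The weight is the Wigner semicircle density, the one-dimensional factor of [kernel_kappa]. *)
Definition semicircle_avg a p x : R :=
  \int[lebesgue_measure]_(u in `[(-1 : R), 1])
    (p.[x + a * u] * (2 / pi * Num.sqrt (1 - u ^+ 2))).

Lemma is_derive_sin_affine p a x (t : R) :
  is_derive t 1 (fun t => p.[x + a * sin t]) (p^`().[x + a * sin t] * (a * cos t)).
Proof.
apply: (@is_derive_compE R (horner p) (fun t => x + a * sin t) t _ _
  (is_derive_poly p _)).
have := is_deriveD (is_derive_cst x t 1) (is_derive_cmulE a (is_derive_sin t)).
by apply: is_derive_ext; rewrite ?add0r.
Qed.

Lemma continuous_semicircle p a x :
  continuous (fun u => p.[x + a * u] * (2 / pi * Num.sqrt (1 - u ^+ 2))).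
Proof.
move=> u; apply: cvgM.
  apply: (@continuous_comp _ _ _ (fun u => x + a * u) (horner p)).
    apply: cvgD; first exact: cvg_cst.
    by apply: cvgM; [exact: cvg_cst|exact: cvg_id].
  exact: continuous_horner.
apply: cvgM; first exact: cvg_cst.
apply: (@continuous_comp _ _ _ (fun u : R => 1 - u ^+ 2) Num.sqrt).
  by apply: cvgB; [exact: cvg_cst|exact: exprn_continuous].
exact: sqrt_continuous.
Qed.

Lemma eq_increment (F G f g : R -> R) (a b : R) : a <= b ->
  (forall t : R, is_derive t 1 F (f t)) -> (forall t : R, is_derive t 1 G (g t)) ->
  (forall t, t \in `]a, b[ -> f t = g t) -> F b - F a = G b - G a.
Proof.
move=> ab dF dG fg; apply/eqP; rewrite -subr_eq0 -normr_le0.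
rewrite (_ : _ - _ = (F - G) b - (F - G) a); last by rewrite !fctE; ring.
rewrite (_ : 0 = (0 : R) - 0); last by rewrite subrr.
apply: (@norm_deriv_le R (F - G) (fun=> 0) (fun s => f s - g s) (fun=> 0)
  a b ab _ _ (fun s _ => is_deriveB (dF s) (dG s))
  (fun s _ => is_derive_cst _ _ _)).
- apply: continuous_subspaceT => s.
  exact: is_derive_continuous (is_deriveB (dF s) (dG s)).
- by apply: continuous_subspaceT => s; exact: cst_continuous.
- by move=> s /fg ->; rewrite subrr normr0.
Qed.

Lemma Rintegral_primitive (F f : R -> R) (a b : R) : a < b -> continuous f ->
  (forall t : R, is_derive t 1 F (f t)) ->
  \int[lebesgue_measure]_(u in `[a, b]) f u = F b - F a.
Proof.
move=> ab cf dF; have cF t : F x @[x --> t] --> F t.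
  exact: is_derive_continuous (dF t).
rewrite /Rintegral (@continuous_FTC2 R f F a b ab) ?fineB//.
- exact: continuous_subspaceT.
- split.
  + by move=> t _; case: (dF t).
  + exact: cvg_at_right_filter.
  + exact: cvg_at_left_filter.
- by move=> t _; rewrite derive1E; case: (dF t).
Qed.

Lemma cos_le0_pihalf (t : R) : pi / 2 <= t <= pi / 2 + pi -> cos t <= 0.
Proof.
move=> /andP[t1 t2]; rewrite -(subrK pi t) cosDpi oppr_le0.
by apply: cos_ge0_pihalf; apply/andP; split; lra.
Qed.

(* [u = sin t] runs through [-1, 1] on each of [-pi/2, pi/2] and
   [pi/2, 3 pi/2], where [sqrt (1 - u^2)] is [cos t] and [- cos t]. *)
Lemma trigpoly_semicircle (X : Type) (xi : X -> R) a p m (x : X) :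
  trigpoly (fun (x : X) t => 2 * p.[xi x + a * sin t] * cos t ^+ 2) m ->
  m x = semicircle_avg a p (xi x).
Proof.
move=> hm; have [K dK hK] := trigpoly_primitive x hm.
have pi0 := pi_gt0 R.
have [H dH] := exists_primitive (@continuous_semicircle p a (xi x)).
have N11 : -1 < 1 :> R by lra.
rewrite /semicircle_avg (Rintegral_primitive N11 (@continuous_semicircle p a _) dH).
(* The factor [pi] cancels that of the weight: the derivative is [2 * p.[xi x + a * sin t] * |cos t|
   * cos t], up to sign the given trigonometric polynomial. *)
have dHs (t : R) := is_derive_cmulE pi (is_derive_compE (dH (sin t)) (is_derive_sin t)).
have sq t : Num.sqrt (1 - sin t ^+ 2) = `|cos t|.
  by rewrite -cos2sin2 sqrtr_sqr.
have e1 : K (pi / 2) - K (- (pi / 2)) =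
    pi * H (sin (pi / 2)) - pi * H (sin (- (pi / 2))).
  apply: (eq_increment _ dK dHs); first lra.
  move=> t; rewrite in_itv/= => /andP[/ltW t1 /ltW t2].
  rewrite sq ger0_norm; last by apply: cos_ge0_pihalf; rewrite t1 t2.
  by move: (lt0r_neq0 pi0); generalize (pi : R) => q q0; field.
have dHn (t : R) := is_derive_cmulE (-1) (dHs t).
have e2 : K (pi / 2 + pi) - K (pi / 2) =
    -1 * (pi * H (sin (pi / 2 + pi))) - -1 * (pi * H (sin (pi / 2))).
  apply: (eq_increment _ dK dHn); first lra.
  move=> t; rewrite in_itv/= => /andP[/ltW t1 /ltW t2].
  rewrite sq ler0_norm; last by apply: cos_le0_pihalf; rewrite t1 t2.
  by move: (lt0r_neq0 pi0); generalize (pi : R) => q q0; field.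
have := hK (- (pi / 2)).
rewrite (_ : - (pi / 2) + pi *+ 2 = pi / 2 + pi); last by rewrite mulr2n; field.
rewrite sinDpi sinN sin_pihalf in e1 e2.
move: e1 e2; set A := H 1; set B := H (- 1) => e1 e2 e3.
have : pi *+ 2 * m x = pi *+ 2 * (A - B) by rewrite -e3 mulr2n; lra.
by apply: mulfI; rewrite mulrn_eq0/= gt_eqF.
Qed.

(* Integration by parts: the derivative of [p.[x + a sin t] * cos t], which is
   periodic, has mean zero. *)
Lemma trigpoly_semicircle_deriv (X : Type) (xi : X -> R) a p m (x : X) : a != 0 ->
  bounded_coef xi ->
  trigpoly (fun (x : X) t => 2 / a * p.[xi x + a * sin t] * sin t) m ->
  m x = semicircle_avg a p^`() (xi x).
Proof.
move=> a0 bxi tm.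
have [m' tm'] : exists m',
    trigpoly (fun (x : X) t => 2 * p^`().[xi x + a * sin t] * cos t ^+ 2) m'.
  have [m1 h1] := trigpoly_horner a p^`() bxi.
  have [m2 h2] := trigpolyM (@trigpoly_cos R X) (@trigpoly_cos R X).
  have [m3 h3] := trigpolyM h1 h2.
  eexists; apply: trigpoly_ext (trigpolyZ (bounded_coef_cst 2) h3) _ _ => //.
  by move=> y t; rewrite mulrA expr2.
rewrite -(trigpoly_semicircle x tm').
have [K dK hK] := trigpoly_primitive x tm.
have [K' dK' hK'] := trigpoly_primitive x tm'.
have dW (t : R) := is_deriveD (dK t) (is_derive_cmulE (2 / a)
  (is_derive_mulE (is_derive_sin_affine p a (xi x) t) (is_derive_cos t))).
have pi0 := pi_gt0 R.
have := @eq_increment _ _ _ _ 0 (0 + pi *+ 2) _ dW dK'.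
rewrite /= !fctE hK' sinD2pi cosD2pi => e.
have : pi *+ 2 * m x = pi *+ 2 * m' x.
  rewrite -e; first by rewrite -(hK 0); ring.
    by rewrite add0r mulrn_wge0// ltW.
  by move=> t _; field.
by apply: mulfI; rewrite mulrn_eq0/= gt_eqF.
Qed.

End semicircle.

(** * Iterated integrals over the cube *)

Section cube_integral.
Context {R : realType}.

Lemma compact_box n (B : R) : compact [set v : 'rV[R]_n | `|v| <= B].
Proof.
have [B0|B0] := leP 0 B; last first.
  rewrite (_ : mkset _ = set0); first exact: compact0.
  by apply/seteqP; split => v //=; rewrite leNgt (lt_le_trans B0).
rewrite (_ : mkset _ = [set v : 'rV[R]_n | forall i, v ord0 i \in `[- B, B]]).
  by apply: (@rV_compact R n (fun=> `[- B, B]%classic)) => i; exact: segment_compact.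
apply/seteqP; split => v /= h.
  move=> i; rewrite in_itv/= -ler_norml.
  by apply: le_trans h; exact: normr_coord.
by apply: normr_rV_le => // i; rewrite ler_norml; have := h i; rewrite in_itv.
Qed.

Definition cons_rV n (t : R) (v : 'rV[R]_n) : 'rV[R]_n.+1 :=
  row_mx (t%:M : 'M[R]_1) v.

Lemma cons_rV0 n t (v : 'rV[R]_n) : cons_rV t v ord0 ord0 = t.
Proof.
rewrite mxE; case: splitP => j //= _.
by rewrite (ord1 j) mxE eqxx mulr1n.
Qed.

Lemma cons_rVS n t (v : 'rV[R]_n) i : cons_rV t v ord0 (lift ord0 i) = v ord0 i.
Proof.
rewrite mxE; case: splitP => j /=; first by case: j => -[].
by rewrite /bump leq0n => /eqP; rewrite eqn_add2l => /eqP ij; congr (v _ _); exact: val_inj.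
Qed.

Lemma normr_cons_rV n t (v : 'rV[R]_n) B : `|t| <= B -> `|v| <= B ->
  `|cons_rV t v| <= B.
Proof.
move=> tB vB; apply: normr_rV_le; first exact: le_trans tB.
move=> i; case: (unliftP ord0 i) => [j|] ->; last by rewrite cons_rV0.
by rewrite cons_rVS; apply: le_trans vB; exact: normr_coord.
Qed.

Lemma continuous_cons_rV n :
  continuous (fun z : 'rV[R]_n * R => cons_rV z.2 z.1).
Proof.
apply: continuous_rVP => i; case: (unliftP ord0 i) => [j|] -> z.
  under eq_fun do rewrite cons_rVS.
  apply: (@continuous_comp _ _ _ fst (fun v : 'rV[R]_n => v ord0 j)).
    exact: cvg_fst.
  exact: coord_continuous.
by under eq_fun do rewrite cons_rV0; exact: cvg_snd.
Qed.

Lemma continuous_slice n (f : 'rV[R]_n.+1 -> R) t : continuous f ->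
  continuous (fun v => f (cons_rV t v)).
Proof.
move=> cf v; apply: (@continuous_comp _ _ _ (@cons_rV n t) f); last exact: cf.
apply: continuous_rVP => i; case: (unliftP ord0 i) => [j|] -> z.
  under eq_fun do rewrite cons_rVS.
  exact: (@coord_continuous R 1 n ord0 j z).
under eq_fun do rewrite cons_rV0.
exact: (@cst_continuous _ _ t z).
Qed.

(** Joint continuity at each point [(v, t)], made uniform in [v] by compactness of the unit box. *)
Lemma slice_unif n (f : 'rV[R]_n.+1 -> R) (t e : R) : continuous f -> 0 < e ->
  \forall s \near t, forall v, `|v| <= 1 ->
    `|f (cons_rV t v) - f (cons_rV s v)| <= e.
Proof.
move=> cf e0.
have e2 : 0 < e / 2 by rewrite divr_gt0.
have := (@compact_near_coveringP _ _).1 (@compact_box n 1) R (nbhs t)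
  (fun s v => `|f (cons_rV t v) - f (cons_rV s v)| <= e).
apply => v v1.
have c2 : {for (v, t), continuous (fun z : 'rV[R]_n * R => f (cons_rV z.2 z.1))}.
  apply: (@continuous_comp _ _ _ (fun z : 'rV[R]_n * R => cons_rV z.2 z.1) f);
    last exact: cf.
  exact: continuous_cons_rV.
have c1 : {for (v, t), continuous (fun z : 'rV[R]_n * R => f (cons_rV t z.1))}.
  apply: (@continuous_comp _ _ _ fst (fun v => f (cons_rV t v))).
    exact: cvg_fst.
  exact: continuous_slice.
have /cvgrPdist_le/(_ _ e2) n1 := c1.
have /cvgrPdist_le/(_ _ e2) n2 := c2.
near=> z.
have h1 : `|f (cons_rV t v) - f (cons_rV t z.1)| <= e / 2.
  by near: z; exact: n1.
have h2 : `|f (cons_rV t v) - f (cons_rV z.2 z.1)| <= e / 2.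
  by near: z; exact: n2.
rewrite distrC in h1.
have := ler_distD (f (cons_rV t v)) (f (cons_rV t z.1)) (f (cons_rV z.2 z.1)).
by rewrite /=; lra.
Unshelve. all: by end_near. Qed.

Lemma Rintegral_dist (F G : R -> R) c : continuous F -> continuous G ->
  (forall t, `|t| <= 1 -> `|F t - G t| <= c) ->
  `|\int[lebesgue_measure]_(t in `[(-1 : R), 1]) F t -
    \int[lebesgue_measure]_(t in `[(-1 : R), 1]) G t| <= 2 * c.
Proof.
move=> cF cG h.
have iF := continuous_integrable (-1) 1 cF.
have iG := continuous_integrable (-1) 1 cG.
have cFG : continuous (fun t => F t - G t).
  by move=> t; apply: cvgB; [exact: cF|exact: cG].
rewrite -RintegralB//; apply: (le_trans (le_normr_Rintegral _ _)) => //.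
  exact: continuous_integrable.
have -> : 2 * c = \int[lebesgue_measure]_(t in `[(-1 : R), 1]) c.
  rewrite Rintegral_cst//= lebesgue_measure_itv/= lte_fin.
  have -> : (-1 < 1 :> R) by lra.
  by rewrite -EFinB/= opprK mulrC.
apply: le_Rintegral => //.
- by apply: continuous_integrable => t; apply: cvg_norm; exact: cFG.
- by apply: continuous_integrable => t; exact: cvg_cst.
- by move=> t; rewrite /= in_itv/= -ler_norml => /h.
Qed.

(** The two claims feed each other: the distance bound in dimension [n] makes slices of functions on
    dimension [n + 1] continuous, hence integrable, as the distance bound in dimension [n + 1]
    needs. *)
Lemma cube_integral_dist_continuous n :
  (forall (f g : 'rV[R]_n -> R) c, continuous f -> continuous g ->
    (forall u, `|u| <= 1 -> `|f u - g u| <= c) ->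
    `|cube_integral f - cube_integral g| <= 2 ^+ n * c) /\
  (forall f : 'rV[R]_n.+1 -> R, continuous f ->
    continuous (fun t => cube_integral (fun v => f (cons_rV t v)))).
Proof.
have slice m : (forall (f g : 'rV[R]_m -> R) c, continuous f -> continuous g ->
    (forall u, `|u| <= 1 -> `|f u - g u| <= c) ->
    `|cube_integral f - cube_integral g| <= 2 ^+ m * c) ->
  (forall f : 'rV[R]_m.+1 -> R, continuous f ->
    continuous (fun t => cube_integral (fun v => f (cons_rV t v)))).
  move=> dist f cf t; apply/cvgrPdist_le => e e0.
  have p0 : 0 < 2 ^+ m :> R by rewrite exprn_gt0.
  near=> s.
  rewrite -(mulVKf (lt0r_neq0 p0) e); apply: dist.
  - exact: continuous_slice.
  - exact: continuous_slice.
  - by near: s; apply: slice_unif => //; rewrite mulr_gt0// invr_gt0.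
suff dist : forall (f g : 'rV[R]_n -> R) c, continuous f -> continuous g ->
    (forall u, `|u| <= 1 -> `|f u - g u| <= c) ->
    `|cube_integral f - cube_integral g| <= 2 ^+ n * c.
  by split; [exact: dist|exact: slice].
elim: n => [|n IH] f g c cf cg h.
  by rewrite /= expr0 mul1r; apply: h; rewrite normr0.
rewrite exprS -mulrA; apply: Rintegral_dist; [exact: slice|exact: slice|].
move=> t t1; apply: IH; [exact: continuous_slice|exact: continuous_slice|].
by move=> u u1; apply: h; exact: normr_cons_rV.
Unshelve. all: by end_near. Qed.

Lemma cube_integral_dist n (f g : 'rV[R]_n -> R) c :
  continuous f -> continuous g ->
  (forall u, `|u| <= 1 -> `|f u - g u| <= c) ->
  `|cube_integral f - cube_integral g| <= 2 ^+ n * c.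
Proof. by have [+ _] := cube_integral_dist_continuous n; exact. Qed.

Lemma continuous_cube_slice n (f : 'rV[R]_n.+1 -> R) : continuous f ->
  continuous (fun t => cube_integral (fun v => f (cons_rV t v))).
Proof. by have [_ +] := cube_integral_dist_continuous n; exact. Qed.

Lemma cube_integralS n (f : 'rV[R]_n.+1 -> R) : cube_integral f =
  \int[lebesgue_measure]_(t in `[(-1 : R), 1])
    cube_integral (fun v => f (cons_rV t v)).
Proof. by []. Qed.

Lemma cube_integralD n (f g : 'rV[R]_n -> R) : continuous f -> continuous g ->
  cube_integral (fun u => f u + g u) = cube_integral f + cube_integral g.
Proof.
elim: n f g => [|n IH] f g cf cg //.
rewrite !cube_integralS -RintegralD//; first last.
- exact/continuous_integrable/continuous_cube_slice.
- exact/continuous_integrable/continuous_cube_slice.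
by apply: eq_Rintegral => t _; apply: IH; exact: continuous_slice.
Qed.

Lemma cube_integralZ n c (f : 'rV[R]_n -> R) : continuous f ->
  cube_integral (fun u => c * f u) = c * cube_integral f.
Proof.
elim: n f => [|n IH] f cf //.
rewrite !cube_integralS -RintegralZl//; last first.
  exact/continuous_integrable/continuous_cube_slice.
by apply: eq_Rintegral => t _; apply: IH; exact: continuous_slice.
Qed.

Lemma cube_integral_prod n (h : 'I_n -> R -> R) : (forall i, continuous (h i)) ->
  cube_integral (fun u : 'rV[R]_n => \prod_i h i (u ord0 i)) =
  \prod_i \int[lebesgue_measure]_(t in `[(-1 : R), 1]) h i t.
Proof.
elim: n h => [|n IH] h ch; first by rewrite /= !big_ord0.
rewrite cube_integralS big_ord_recl -RintegralZr//; last exact: continuous_integrable.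
apply: eq_Rintegral => t _; rewrite -IH// -cube_integralZ.
  congr cube_integral; apply/funext => v.
  rewrite big_ord_recl cons_rV0; congr (_ * _).
  by apply: eq_bigr => i _; rewrite cons_rVS.
apply: continuous_prodE => i _ v.
apply: (@continuous_comp _ _ _ (fun v : 'rV[R]_n => v ord0 i) (h (lift ord0 i))).
  exact: coord_continuous.
exact: ch.
Qed.

End cube_integral.

(** * The smoothed cost: continuity, linearity and factorization *)

Section smoothed_cost.
Context {R : realType} {n : nat} (a : R).
Implicit Types (J : 'rV[R]_n -> R) (x : 'rV[R]_n).

Lemma continuous_J_avg_integrand J x : continuous J ->
  continuous (fun u : 'rV[R]_n => J (x + a *: u) * kernel_kappa u).
Proof.
move=> cJ.
have cx : continuous (fun u : 'rV[R]_n => x + a *: u).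
  apply: continuous_rVP => i u; under eq_fun do rewrite !mxE.
  exact: (cvgD (@cst_continuous _ _ (x ord0 i) u)
    (cvgM (@cst_continuous _ _ a u) (@coord_continuous R 1 n ord0 i u))).
have cJx : continuous (fun u : 'rV[R]_n => J (x + a *: u)).
  move=> u; exact: (continuous_comp (cx u) (cJ (x + a *: u))).
have cp : continuous (fun u : 'rV[R]_n => \prod_j Num.sqrt (1 - u ord0 j ^+ 2)).
  apply: continuous_prodE => j _ v.
  apply: (@continuous_comp _ _ _ (fun v : 'rV[R]_n => v ord0 j)
    (fun u => Num.sqrt (1 - u ^+ 2))); first exact: coord_continuous.
  apply: (@continuous_comp _ _ _ (fun u : R => 1 - u ^+ 2) Num.sqrt).
    by apply: cvgB; [exact: cvg_cst|exact: exprn_continuous].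
  exact: sqrt_continuous.
have ck : continuous (@kernel_kappa R n).
  by move=> v; exact: (cvgM (@cst_continuous _ _ ((2 / pi) ^+ n) v) (cp v)).
by move=> u; exact: (cvgM (cJx u) (ck u)).
Qed.

Lemma kernel_kappa_le (u : 'rV[R]_n) : `|kernel_kappa u| <= (2 / pi) ^+ n.
Proof.
have p0 : 0 <= (2 / pi) ^+ n :> R by rewrite exprn_ge0// divr_ge0// pi_ge0.
rewrite /kernel_kappa normrM ger0_norm// ler_piMr// normr_prod.
apply: prodr_ile1 => i _; rewrite normr_ge0/= ger0_norm ?sqrtr_ge0//.
by rewrite -[leRHS]sqrtr1 ler_wsqrtr// gerBl sqr_ge0.
Qed.

Lemma J_avg_dist J J' x c : continuous J -> continuous J' ->
  0 <= a -> (forall y, `|y| <= `|x| + a -> `|J y - J' y| <= c) ->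
  `|J_avg a J x - J_avg a J' x| <= 2 ^+ n * (c * (2 / pi) ^+ n).
Proof.
move=> cJ cJ' a0 h; apply: cube_integral_dist.
- exact: continuous_J_avg_integrand.
- exact: continuous_J_avg_integrand.
- move=> u u1; rewrite -mulrBl normrM; apply: ler_pM => //.
    apply: h; apply: (le_trans (ler_normD _ _)); rewrite lerD2l normrZ ger0_norm//.
    by rewrite ler_piMr.
  exact: kernel_kappa_le.
Qed.

Lemma J_avg_prod (p : 'I_n -> {poly R}) x :
  J_avg a (fun y => \prod_j (p j).[y ord0 j]) x =
  \prod_j semicircle_avg a (p j) (x ord0 j).
Proof.
rewrite /semicircle_avg -(cube_integral_prod (h := fun j u =>
  (p j).[x ord0 j + a * u] * (2 / pi * Num.sqrt (1 - u ^+ 2)))).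
  congr cube_integral; apply/funext => u.
  rewrite /kernel_kappa -[n in _ ^+ n]card_ord -prodr_const -!big_split/=.
  by apply: eq_bigr => j _; rewrite !mxE.
by move=> j; exact: continuous_semicircle.
Qed.

Lemma J_avg_sum (I : Type) (r : seq I) (c : I -> R) (F : I -> 'rV[R]_n -> R) x :
  (forall k, continuous (F k)) ->
  J_avg a (fun y => \sum_(k <- r) c k * F k y) x =
  \sum_(k <- r) c k * J_avg a (F k) x.
Proof.
move=> cF; elim: r => [|k r IH].
  rewrite big_nil /J_avg.
  rewrite (_ : (fun _ => _) = fun u => 0 * kernel_kappa u); last first.
    by apply/funext => u; rewrite big_nil.
  rewrite cube_integralZ ?mul0r// => u.
  have := @continuous_J_avg_integrand (fun=> 1) x (fun y => @cst_continuous _ _ (1 : R) y) u.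
  by under eq_fun do rewrite mul1r.
rewrite big_cons -IH /J_avg.
rewrite -cube_integralZ; last exact: continuous_J_avg_integrand.
rewrite -cube_integralD.
- by congr cube_integral; apply/funext => u; rewrite big_cons mulrDl mulrA.
- by move=> u; exact: (cvgM (@cst_continuous _ _ (c k) u)
    (@continuous_J_avg_integrand (F k) x (cF k) u)).
- apply: (@continuous_J_avg_integrand (fun y => \sum_(j <- r) c j * F j y)).
  apply: continuous_sumE => j _ y.
  exact: (cvgM (@cst_continuous _ _ (c j) y) (cF j y)).
Qed.

End smoothed_cost.

(** * The averaged field of a separable polynomial cost *)

Section directional_derivative.
Context {R : realType} {V : normedModType R}.

Lemma is_derive_line (f : V -> R) (x v : V) (t d : R) :
  is_derive (t *: v + x) v f d <-> is_derive t 1 (fun h => f (h *: v + x)) d.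
Proof.
have e : (fun h : R => h^-1 *: (f (h *: v + (t *: v + x)) - f (t *: v + x))) =
    (fun h : R => h^-1 *: (f ((h *: 1 + t) *: v + x) - f (t *: v + x))).
  by apply/funext => h; rewrite scalerDl addrA [h *: 1]mulr1.
by split=> -[h1 h2]; apply: DeriveDef;
  move: h1 h2; rewrite /derivable /derive/= e.
Qed.

End directional_derivative.

Section semicircle_derivative.
Context {R : realType}.
Implicit Types (p : {poly R}) (a x : R).

Lemma Rintegral_lincomb (I : Type) (r : seq I) (c : I -> R) (F : I -> R -> R)
    (b d : R) : (forall i, continuous (F i)) ->
  \int[lebesgue_measure]_(t in `[b, d]) (\sum_(i <- r) c i * F i t) =
  \sum_(i <- r) c i * \int[lebesgue_measure]_(t in `[b, d]) F i t.
Proof.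
move=> cF; elim: r => [|i r IH].
  rewrite big_nil; under eq_Rintegral do rewrite big_nil.
  by rewrite Rintegral_cst//= mul0r.
rewrite big_cons -IH -RintegralZl//; last exact: continuous_integrable.
rewrite -RintegralD//.
- by apply: eq_Rintegral => t _; rewrite big_cons.
- by apply: continuous_integrable => t; apply: cvgM; [exact: cvg_cst|exact: cF].
- apply: continuous_integrable; apply: continuous_sumE => j _ t.
  by apply: cvgM; [exact: cvg_cst|exact: cF].
Qed.

(** Taylor's formula makes the average a polynomial in [h], so its derivative is read off the linear
    coefficient without differentiating under the integral. The length [(size p).+2] ensures that
    this coefficient is present even for [p = 0]. *)
Lemma semicircle_avg_taylor a p x h : semicircle_avg a p (x + h) =
  \sum_(l < (size p).+2) h ^+ l * semicircle_avg a p^`N(l) x.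
Proof.
rewrite -(Rintegral_lincomb _ (fun l : 'I_(size p).+2 => h ^+ l)
  (F := fun l u => (p^`N(l)).[x + a * u] * (2 / pi * Num.sqrt (1 - u ^+ 2)))).
  apply: eq_Rintegral => u _.
  rewrite addrAC (nderiv_taylor_wide (n := (size p).+2)); last 2 first.
  - exact: mulrC.
  - by rewrite ltnW// ltnW.
  by rewrite mulr_suml; apply: eq_bigr => l _; ring.
by move=> l; exact: continuous_semicircle.
Qed.

Lemma is_derive_semicircle_avg a p (x : R) :
  is_derive x 1 (semicircle_avg a p) (semicircle_avg a p^`() x).
Proof.
pose r := \poly_(l < (size p).+2) semicircle_avg a p^`N(l) x.
have dr : is_derive x 1 (fun y => r.[1 * y + - x]) (r^`().[1 * x + - x] * 1).
  exact: (@is_derive_compE R (horner r) (fun y => 1 * y + - x) x _ _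
    (is_derive_poly r _) (is_derive_affine 1 (- x) x)).
apply: is_derive_ext dr => [y|].
  rewrite mul1r -{2}(subrK x y) (addrC _ x) semicircle_avg_taylor horner_poly.
  by apply: eq_bigr => l _; rewrite mulrC.
by rewrite mul1r subrr mulr1 horner_coef0 coef_deriv coef_poly nderivn1.
Qed.

End semicircle_derivative.

Section polynomial_cost.
Context {R : realType} {n : nat} (a : R) (w : 'rV[R]_n).
Hypotheses (a0 : a != 0) (w_indep : rationally_independent w).
Variables (I : finType) (c : I -> R) (p : I -> 'I_n -> {poly R}).

Definition separable_poly (y : 'rV[R]_n) : R :=
  \sum_k c k * \prod_j (p k j).[y ord0 j].

Lemma continuous_prod_horner (q : 'I_n -> {poly R}) :
  continuous (fun y : 'rV[R]_n => \prod_j (q j).[y ord0 j]).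
Proof.
apply: continuous_prodE => j _ y.
apply: (@continuous_comp _ _ _ (fun v : 'rV[R]_n => v ord0 j) (horner (q j))).
  exact: coord_continuous.
exact: continuous_horner.
Qed.

Lemma continuous_separable_poly : continuous separable_poly.
Proof.
rewrite /separable_poly; apply: continuous_sumE => k _ y.
exact: (cvgM (@cst_continuous _ _ (c k) y) (@continuous_prod_horner (p k) y)).
Qed.

(** The link between the two sides: this expression is the partial derivative of the smoothed cost
    and also minus the time average of the field. *)
Definition separable_partial i (x : 'rV[R]_n) : R :=
  \sum_k c k * (semicircle_avg a (p k i)^`() (x ord0 i) *
    \prod_(j | j != i) semicircle_avg a (p k j) (x ord0 j)).

Lemma is_derive_J_avg_separable i x :
  is_derive x (delta_mx ord0 i : 'rV[R]_n) (J_avg a separable_poly)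
    (separable_partial i x).
Proof.
rewrite -[x]add0r -[X in X + x](scale0r (delta_mx ord0 i)); apply/is_derive_line.
rewrite scale0r add0r.
pose Q k := \prod_(j | j != i) semicircle_avg a (p k j) (x ord0 j).
pose G k (h : R) := (c k * Q k) * semicircle_avg a (p k i) (1 * h + x ord0 i).
have dG k : is_derive (0 : R) 1 (G k)
    (c k * (semicircle_avg a (p k i)^`() (x ord0 i) * Q k)).
  rewrite [X in is_derive _ _ _ X](_ : _ =
    (c k * Q k) * (semicircle_avg a (p k i)^`() (1 * 0 + x ord0 i) * 1)); last first.
    by rewrite mulr0 add0r; ring.
  apply: is_derive_cmulE.
  exact: (@is_derive_compE R (semicircle_avg a (p k i)) (fun h => 1 * h + x ord0 i)
    0 _ _ (is_derive_semicircle_avg a (p k i) _) (is_derive_affine 1 _ 0)).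
have -> : (fun h : R => J_avg a separable_poly (h *: delta_mx ord0 i + x)) =
    (fun h => \sum_k G k h).
  apply/funext => h; rewrite J_avg_sum; last by move=> k; exact: continuous_prod_horner.
  apply: eq_bigr => k _; rewrite J_avg_prod (bigD1 i)//= /G !mxE !eqxx mulr1 mul1r.
  rewrite (_ : \prod_(_ | _) _ = Q k); first by ring.
  by apply: eq_bigr => j /negPf ji; rewrite !mxE ji andbF mulr0 add0r.
exact: is_derive_sumE.
Qed.

(** Each coordinate receives one factor 2 of [2 ^+ n], and coordinate [i] also [1 / a]; every factor
    is then exactly one of the trigonometric polynomials whose mean is a semicircle average. *)
Lemma ES_field_separable i x theta : ES_field separable_poly a x theta ord0 i =
  \sum_k c k * - \prod_j (if j == i
    then 2 / a * (p k i).[x ord0 i + a * sin (theta ord0 i)] * sin (theta ord0 i)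
    else 2 * (p k j).[x ord0 j + a * sin (theta ord0 j)] * cos (theta ord0 j) ^+ 2).
Proof.
rewrite mxE /separable_poly mulr_sumr !mulr_suml; apply: eq_bigr => k _.
rewrite (eq_bigr (fun j => (p k j).[x ord0 j + a * sin (theta ord0 j)]));
  last by move=> j _; rewrite !mxE.
rewrite (bigD1 i)//= [in RHS](bigD1 i)//= eqxx.
rewrite [in RHS](eq_bigr (fun j => 2 * (p k j).[x ord0 j + a * sin (theta ord0 j)] *
  cos (theta ord0 j) ^+ 2)); last by move=> j /negPf ->.
have -> : 2 ^+ n = 2 * \prod_(j < n | j != i) 2 :> R.
  by rewrite -[n in LHS]card_ord -prodr_const (bigD1 i).
by rewrite !big_split/=; ring.
Qed.

Lemma mean_value_ES_separable (B : R) i :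
  mean_value (fun (x : {x : 'rV[R]_n | `|x| <= B}) t =>
      ES_field separable_poly a (sval x) (t *: w) ord0 i)
    (fun x => - separable_partial i (sval x)).
Proof.
pose X := {x : 'rV[R]_n | `|x| <= B}.
(* The state enters through the coefficients of the trigonometric polynomials; confining it to a box
   bounds them. *)
have bxi j : bounded_coef (fun x : X => sval x ord0 j).
  by exists B => -[x hx] /=; apply: le_trans hx; exact: normr_coord.
pose F k j (x : X) t := if j == i
  then 2 / a * (p k i).[sval x ord0 i + a * sin t] * sin t
  else 2 * (p k j).[sval x ord0 j + a * sin t] * cos t ^+ 2.
pose M k j (x : X) := if j == i
  then semicircle_avg a (p k i)^`() (sval x ord0 i)
  else semicircle_avg a (p k j) (sval x ord0 j).
have hF k j : trigpoly (F k j) (M k j).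
  rewrite /F /M; have [_|_] := eqVneq j i.
    have [m1 h1] := trigpoly_horner a (p k i) (bxi i).
    have [m2 h2] := trigpolyM (trigpolyZ (bounded_coef_cst (2 / a)) h1)
      (@trigpoly_sin R X).
    apply: (trigpoly_ext h2) => // x.
    exact: (trigpoly_semicircle_deriv x a0 (bxi i) h2).
  have [m1 h1] := trigpoly_horner a (p k j) (bxi j).
  have [m2 h2] := trigpolyM (@trigpoly_cos R X) (@trigpoly_cos R X).
  have [m3 h3] := trigpolyM (trigpolyZ (bounded_coef_cst 2) h1) h2.
  have h4 : trigpoly (fun (x : X) t =>
    2 * (p k j).[sval x ord0 j + a * sin t] * cos t ^+ 2) m3.
    by apply: trigpoly_ext h3 _ _ => // x t; rewrite expr2.
  by apply: (trigpoly_ext h4) => // x; exact: trigpoly_semicircle h4.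
have h := mean_value_sum (index_enum I) (fun k =>
  mean_valueZ (bounded_coef_cst (- c k)) (mean_value_prod w_indep (hF k))).
apply: (mean_value_ext h) => [x t|x].
  rewrite ES_field_separable; apply: eq_bigr => k _; rewrite mulrN mulNr.
  congr (- (_ * _)); apply: eq_bigr => j _; rewrite /F !mxE.
  by have [->|_] := eqVneq j i; rewrite (mulrC t).
rewrite -sumrN; apply: eq_bigr => k _; rewrite mulNr; congr (- (_ * _)).
rewrite (bigD1 i)//= /M eqxx; congr (_ * _).
by apply: eq_bigr => j /negPf ->.
Qed.

End polynomial_cost.

(** * Approximation of locally Lipschitz costs *)

Section lipschitz_on_boxes.
Context {R : realType} {n : nat} (J : 'rV[R]_n -> R).
Hypothesis J_lip : locally_lipschitz J.

Lemma near_normB_lt (x : 'rV[R]_n) r : 0 < r -> \forall y \near x, `|x - y| < r.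
Proof. by move=> r0; apply/nbhs_ballP; exists r => // y; rewrite -ball_normE. Qed.

Lemma locally_lipschitz_ball (x : 'rV[R]_n) : exists2 r, 0 < r & exists2 M, 0 <= M &
  forall y z, `|x - y| < r -> `|x - z| < r -> `|J y - J z| <= M * `|y - z|.
Proof.
have [U /nbhs_ballP[r /= r0 rU] [M [Mreal hM]]] := J_lip x.
(* The library notion provides the inequality for all constants strictly above [M]. *)
exists r => //; exists (Num.max 0 (M + 1)); first by rewrite le_max lexx.
move=> y z xy xz.
have : M < Num.max 0 (M + 1) by rewrite lt_max ltrDl ltr01 orbT.
move/hM => /(_ (y, z)); apply.
by split; apply: rU; rewrite -ball_normE.
Qed.

Lemma locally_lipschitz_continuous : continuous J.
Proof.
move=> x; have [r r0 [M M0 h]] := locally_lipschitz_ball x.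
have M1 : 0 < M + 1 by rewrite ltr_wpDl.
apply: ((@cvgrPdist_le _ _ _ (nbhs x) (nbhs_filter x) J (J x)).2 _) => e e0.
have m0 : 0 < Num.min r (e / (M + 1)) by rewrite lt_min r0 divr_gt0.
apply: filterS (near_normB_lt x m0) => y; rewrite lt_min => /andP[xy xye].
apply: (le_trans (h x y _ xy)); first by rewrite subrr normr0.
move: xye; rewrite ltr_pdivlMr// => /ltW xye.
by apply: le_trans xye; rewrite mulrC ler_wpM2l// lerDl.
Qed.

Lemma bounded_on_box B : exists C, forall x, `|x| <= B -> `|J x| <= C.
Proof.
have := (@compact_near_coveringP _ _).1 (@compact_box R n B) R (pinfty_nbhs R)
  (fun C x => `|J x| <= C) _.
case=> [x _|C [_ hC]]; last first.
  by exists (C + 1) => x xB; apply: (hC (C + 1)) => //; rewrite ltrDl.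
have cJx : \forall z \near x, `|J x - J z| <= 1.
  exact: ((@cvgrPdist_le _ _ _ (nbhs x) (nbhs_filter x) J (J x)).1
    (@locally_lipschitz_continuous x) 1 ltr01).
exists ([set z | `|J x - J z| <= 1], [set C | `|J x| + 1 <= C]).
  by split => //; exact: nbhs_pinfty_ge.
move=> [z C] /= [xz Cx]; apply: le_trans Cx.
by have := ler_normB (J x) (J x - J z); rewrite opprB addrC subrK; lra.
Qed.

(** By compactness finitely many local constants suffice for close pairs. For pairs at distance at
    least [r / 2] the difference is at most [2 * C], which yields the slope [4 * C / r]. *)
Lemma lipschitz_on_box B : exists2 L, 0 <= L &
  forall x y, `|x| <= B -> `|y| <= B -> `|J x - J y| <= L * `|x - y|.
Proof.
have [C hC] := bounded_on_box B.
have := (@compact_near_coveringP _ _).1 (@compact_box R n B) R (pinfty_nbhs R)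
  (fun L x => `|x| <= B -> forall y, `|y| <= B -> `|J x - J y| <= L * `|x - y|) _.
case=> [x xB|M [_ hM]]; last first.
  exists (`|M| + 1); first by rewrite addr_ge0.
  move=> x y xB yB; apply: (hM (`|M| + 1) _ x xB xB y yB).
  by apply: (le_lt_trans (ler_norm M)); rewrite ltrDl.
have [r r0 [M M0 h]] := locally_lipschitz_ball x.
have C0 : 0 <= C by apply: le_trans (hC x xB).
exists ([set z | `|x - z| < r / 2], [set L | M <= L /\ 4 * C / r <= L]).
  split; first by apply: near_normB_lt; rewrite divr_gt0.
  exact: filterI (nbhs_pinfty_ge (num_real M)) (nbhs_pinfty_ge (num_real _)).
move=> [z K] /= [xz [Mz Cz]] zB y yB.
have [xy|xy] := ltP `|x - y| r.
  apply: (le_trans (h z y _ xy)); first by rewrite (lt_trans xz)//; lra.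
  by apply: ler_wpM2r.
have zy : r / 2 <= `|z - y|.
  by have := ler_distD z x y; lra.
apply: (@le_trans _ _ (2 * C)).
  apply: (le_trans (ler_normB _ _)).
  by have := hC _ zB; have := hC _ yB; lra.
apply: (@le_trans _ _ (4 * C / r * (r / 2))).
  rewrite le_eqVlt; apply/orP; left; apply/eqP; field.
  by rewrite gt_eqF.
apply: ler_pM => //; first by rewrite divr_ge0// ?mulr_ge0// ltW.
by rewrite divr_ge0// ltW.
Qed.

End lipschitz_on_boxes.

(** * Bernstein approximation in several variables *)

Section bernstein.
Context {R : realType}.
Implicit Types (q : {poly R}) (g : nat -> R).

(* The binomial distribution with success probability [q.[t]], by conditioning
   on the last trial. *)
Fixpoint bernstein q (N k : nat) : {poly R} :=
  if N is N'.+1 then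
    q * (if k is k'.+1 then bernstein q N' k' else 0) +
    (1 - q) * bernstein q N' k
  else (k == 0%N)%:R.

Lemma bernstein_small q N k : (N < k)%N -> bernstein q N k = 0.
Proof.
elim: N k => [|N IH] [|k]//= Nk.
by rewrite !IH ?mulr0 ?addr0// ltnW.
Qed.

Lemma bernstein_ge0 q N k y : 0 <= q.[y] <= 1 -> 0 <= (bernstein q N k).[y].
Proof.
move=> /andP[q0 q1]; elim: N k => [|N IH] k.
  by rewrite /=; case: (k == 0%N); rewrite hornerC.
rewrite /= hornerD !hornerM hornerD hornerN hornerC addr_ge0//.
  by apply: mulr_ge0 => //; case: k => [|k]; rewrite ?horner0.
by apply: mulr_ge0 => //; rewrite subr_ge0.
Qed.

Lemma bernstein_sumS q N g y :
  \sum_(k < N.+2) g k * (bernstein q N.+1 k).[y] =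
  q.[y] * (\sum_(k < N.+1) g k.+1 * (bernstein q N k).[y]) +
  (1 - q.[y]) * (\sum_(k < N.+1) g k * (bernstein q N k).[y]).
Proof.
have e (k : 'I_N.+2) : g k * (bernstein q N.+1 k).[y] =
    q.[y] * (g k * (if (k : nat) is k'.+1 then bernstein q N k' else 0).[y]) +
    (1 - q.[y]) * (g k * (bernstein q N k).[y]).
  by rewrite [bernstein]lock /= -lock /= hornerD !hornerM hornerD hornerN hornerC; ring.
rewrite (eq_bigr _ (fun k _ => e k)) big_split/= -!mulr_sumr; congr (_ * _ + _ * _).
  by rewrite big_ord_recl/= horner0 mulr0 add0r.
by rewrite big_ord_recr/= bernstein_small// horner0 mulr0 addr0.
Qed.

Lemma bernstein_sum1 q N y : \sum_(k < N.+1) (bernstein q N k).[y] = 1.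
Proof.
suff h : \sum_(k < N.+1) 1 * (bernstein q N k).[y] = 1.
  by rewrite -[RHS]h; apply: eq_bigr => k _; rewrite mul1r.
elim: N => [|N IH]; first by rewrite big_ord1 /= hornerC mul1r.
by rewrite (bernstein_sumS q N (fun=> 1)) !IH !mulr1 addrC subrK.
Qed.

(** The centre [s] is free because conditioning on a success replaces [s] by [s - 1]. The variance
    is the case [s = N%:R * q.[y]]. *)
Lemma bernstein_variance q N s y :
  \sum_(k < N.+1) (k%:R - s) ^+ 2 * (bernstein q N k).[y] =
  N%:R * q.[y] * (1 - q.[y]) + (N%:R * q.[y] - s) ^+ 2.
Proof.
elim: N s => [|N IH] s.
  by rewrite big_ord1 /= hornerC; ring.
rewrite (bernstein_sumS q N (fun k => (k%:R - s) ^+ 2)) IH.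
rewrite (eq_bigr (fun k : 'I_N.+1 => (k%:R - (s - 1)) ^+ 2 * (bernstein q N k).[y])).
  by rewrite IH -natr1; ring.
by move=> k _; rewrite -natr1; congr (_ ^+ 2 * _); ring.
Qed.

(** Under a product distribution, the expectation of a function of coordinate [j] only involves the
    [j]-th marginal. *)
Lemma sum_ffun_prod (n N : nat) (b : 'I_n -> 'I_N.+1 -> R) (G : 'I_N.+1 -> R) j :
  (forall i, \sum_k b i k = 1) ->
  \sum_(f : {ffun 'I_n -> 'I_N.+1}) G (f j) * \prod_i b i (f i) =
  \sum_k G k * b j k.
Proof.
move=> b1.
pose F i k := if i == j then G k * b i k else b i k.
have e : \prod_i \sum_k F i k = \sum_k G k * b j k.
  rewrite (bigD1 j)//= [X in _ * X]big1 ?mulr1.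
    by apply: eq_bigr => k _; rewrite /F eqxx.
  by move=> i /negPf ij; rewrite -[RHS](b1 i); apply: eq_bigr => k _; rewrite /F ij.
rewrite -e bigA_distr_bigA; apply: eq_bigr => f _.
rewrite (bigD1 j)//= [in RHS](bigD1 j)//= /F eqxx mulrA; congr (_ * _).
by apply: eq_bigr => i /negPf ->.
Qed.

(* The error is estimated with [|d| <= delta + d^2 / delta] and the variance of
   the binomial distribution. *)
Lemma separable_approximation n (J : 'rV[R]_n -> R) (B L eta : R) :
  0 < B -> 0 <= L -> 0 < eta ->
  (forall x y, `|x| <= B -> `|y| <= B -> `|J x - J y| <= L * `|x - y|) ->
  exists N (c : {ffun 'I_n -> 'I_N.+1} -> R)
      (p : {ffun 'I_n -> 'I_N.+1} -> 'I_n -> {poly R}),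
    forall y, `|y| <= B -> `|J y - separable_poly c p y| <= eta.
Proof.
move=> B0 L0 eta0 JL.
(* Each coordinate will cost [2 * delta]: one [delta] from the inequality, one from the variance
   once [(2 * B) ^+ 2 <= delta ^+ 2 * M%:R]. The total [L * n%:R * (2 * delta)] is below
   [K * (2 * delta) = eta], and the [+ 1] keeps [K] positive. *)
pose K := L * n%:R + 1.
have K0 : 0 < K by rewrite ltr_wpDl// mulr_ge0.
pose delta := eta / (2 * K).
have d0 : 0 < delta by rewrite divr_gt0// mulr_gt0.
pose A := (2 * B) ^+ 2 / (delta ^+ 2).
have A0 : 0 <= A by rewrite divr_ge0// sqr_ge0.
have [N hN] : exists N, A <= N%:R.
  by exists (Num.bound A); apply: ltW; exact: archi_boundP.
pose M := N.+1.
have M0 : 0 < M%:R :> R by rewrite ltr0n.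
have AM : A <= M%:R by apply: (le_trans hN); rewrite ler_nat.
pose q : {poly R} := (2 * B)^-1 *: ('X + B%:P).
have qE y : q.[y] = (y + B) / (2 * B).
  by rewrite /q hornerZ hornerD hornerX hornerC mulrC.
have B2 : 0 < 2 * B by rewrite mulr_gt0.
have q01 y : `|y| <= B -> 0 <= q.[y] <= 1.
  rewrite ler_norml => /andP[y1 y2]; rewrite qE divr_ge0 ?ler_pdivrMr//=; lra.
pose node (k : 'I_M.+1) : R := - B + 2 * B * (k%:R / M%:R).
pose c (f : {ffun 'I_n -> 'I_M.+1}) := J (\row_j node (f j)).
pose p (f : {ffun 'I_n -> 'I_M.+1}) (j : 'I_n) := bernstein q M (f j).
have nodeB k : `|node k| <= B.
  have : 0 <= (k%:R / M%:R : R) <= 1.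
    apply/andP; split; first by apply: divr_ge0; rewrite ler0n.
    by rewrite ler_pdivrMr// mul1r ler_nat -ltnS.
  by rewrite /node ler_norml => /andP[k0 k1]; apply/andP; split; nra.
exists M, c, p => y yB.
have yjB j : `|y ord0 j| <= B by apply: le_trans yB; exact: normr_coord.
pose b j (k : 'I_M.+1) := (bernstein q M k).[y ord0 j].
have b0 j k : 0 <= b j k by apply: bernstein_ge0; exact: q01.
have b1 j : \sum_k b j k = 1 by exact: bernstein_sum1.
pose W (f : {ffun 'I_n -> 'I_M.+1}) := \prod_j b j (f j).
have W0 f : 0 <= W f by apply: prodr_ge0.
have W1 : \sum_f W f = 1.
  rewrite /W -bigA_distr_bigA big1//.
have dist f : `|J y - c f| <= L * \sum_j (delta + (y ord0 j - node (f j)) ^+ 2 / delta).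
  apply: (le_trans (JL _ _ yB _)).
    by apply: normr_rV_le (ltW B0) _ => j; rewrite mxE.
  have T0 j : 0 <= delta + (y ord0 j - node (f j)) ^+ 2 / delta.
    apply: addr_ge0; first exact: ltW.
    by apply: divr_ge0; [exact: sqr_ge0|exact: ltW].
  apply: ler_wpM2l => //; apply: normr_rV_le; first exact: sumr_ge0.
  move=> j; rewrite !mxE (bigD1 j)//=; apply: ler_wpDr; first exact: sumr_ge0.
  set d := y ord0 j - node (f j).
  rewrite -(ler_pM2r d0) mulrDl divfK ?gt_eqF//.
  have := sqr_ge0 (`|d| - delta); rewrite -(real_normK (num_real d)).
  have := normr_ge0 d; nra.
have var j : \sum_k (delta + (y ord0 j - node k) ^+ 2 / delta) * b j k <= 2 * delta.
  have -> : \sum_k (delta + (y ord0 j - node k) ^+ 2 / delta) * b j k =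
      delta * (\sum_k b j k) + (2 * B) ^+ 2 / (M%:R ^+ 2 * delta) *
        \sum_(k < M.+1) (k%:R - M%:R * q.[y ord0 j]) ^+ 2 * b j k.
    rewrite !mulr_sumr -big_split/=; apply: eq_bigr => k _.
    rewrite /node qE; field.
    by rewrite !gt_eqF.
  rewrite b1 bernstein_variance subrr expr0n addr0 mulr1.
  have /andP[qa qb] := q01 _ (yjB j); set t := q.[_] in qa qb *.
  rewrite (_ : _ / _ * _ = ((2 * B) ^+ 2 * (t * (1 - t))) / (delta * M%:R));
    last by field; rewrite !gt_eqF.
  suff : (2 * B) ^+ 2 * (t * (1 - t)) / (delta * M%:R) <= delta by lra.
  have dM0 : 0 < delta * M%:R by exact: mulr_gt0.
  rewrite ler_pdivrMr//.
  have : (2 * B) ^+ 2 <= delta ^+ 2 * M%:R.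
    by rewrite [leRHS]mulrC -ler_pdivrMr ?exprn_gt0.
  have := sqr_ge0 (2 * B).
  have : 0 <= t * (1 - t) <= 1 by nra.
  by rewrite expr2; nra.
rewrite [X in `|X|](_ : _ = \sum_f (J y - c f) * W f); last first.
  transitivity (J y * \sum_f W f - separable_poly c p y); first by rewrite W1 mulr1.
  by rewrite mulr_sumr -sumrB; apply: eq_bigr => f _; rewrite mulrBl.
apply: (le_trans (ler_norm_sum _ _ _)).
pose D (f : {ffun 'I_n -> 'I_M.+1}) := \sum_j (delta + (y ord0 j - node (f j)) ^+ 2 / delta).
have h1 : \sum_f `|(J y - c f) * W f| <= \sum_f L * (D f * W f).
  apply: ler_sum => f _; rewrite normrM (ger0_norm (W0 f)) mulrA.
  by apply: ler_wpM2r.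
apply: (le_trans h1); rewrite -mulr_sumr /D.
under eq_bigr do rewrite mulr_suml.
rewrite exchange_big/=.
apply: (@le_trans _ _ (L * \sum_(j < n) 2 * delta)).
  apply: ler_wpM2l => //; apply: ler_sum => j _.
  by rewrite (sum_ffun_prod (fun k => delta + (y ord0 j - node k) ^+ 2 / delta) j b1).
rewrite sumr_const card_ord -mulr_natl.
rewrite [leLHS](_ : _ = (K - 1) * (2 * delta)); last by rewrite /K; ring.
rewrite [leRHS](_ : _ = K * (2 * delta)); last first.
  by rewrite /delta; field; rewrite gt_eqF.
by apply: ler_wpM2r; [rewrite mulr_ge0// ltW|rewrite gerBl].
Qed.

End bernstein.

(** * Averaging of the extremum seeking field *)

Section averaging.
Context {R : realType} {n : nat} (a : R) (w : 'rV[R]_n).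
Hypotheses (a_gt0 : 0 < a) (w_indep : rationally_independent w).
Implicit Types (J P Q : 'rV[R]_n -> R) (x : 'rV[R]_n) (i : 'I_n).

Let D : R := 2 ^+ n / a.
Let D_ge0 : 0 <= D. Proof. by rewrite divr_ge0 ?exprn_ge0// ltW. Qed.

Lemma ES_fieldE (theta : 'rV[R]_n) i : exists2 k : R, `|k| <= 1 &
  forall J x, ES_field J a x theta ord0 i = D * (k * J (x + a *: map_mx sin theta)).
Proof.
exists (- (sin (theta ord0 i) * \prod_(j | j != i) cos (theta ord0 j) ^+ 2)).
  rewrite normrN normrM -[leRHS]mulr1; apply: ler_pM => //; first exact: sin_max.
  rewrite normr_prod; apply: prodr_ile1 => j _; rewrite normr_ge0/=.
  by rewrite normrX exprn_ile1// cos_max.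
by move=> J x; rewrite mxE /D; ring.
Qed.

Lemma ES_field_dist J J' x y theta i c :
  `|J (x + a *: map_mx sin theta) - J' (y + a *: map_mx sin theta)| <= c ->
  `|ES_field J a x theta ord0 i - ES_field J' a y theta ord0 i| <= D * c.
Proof.
have [k k1 kE] := ES_fieldE theta i.
rewrite !kE -mulrBr -mulrBr normrM (ger0_norm D_ge0) => h.
apply: ler_wpM2l => //; rewrite normrM -[leRHS]mul1r.
by apply: ler_pM.
Qed.

Lemma normr_dither theta : `|a *: map_mx sin theta : 'rV[R]_n| <= a.
Proof.
apply: normr_rV_le => [|i]; first exact: ltW.
by rewrite !mxE normrM (gtr0_norm a_gt0) ler_piMr ?sin_max// ltW.
Qed.

Lemma continuous_ES_field_along J (x theta : R -> 'rV[R]_n) i :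
  continuous J -> continuous x -> continuous theta ->
  continuous (fun t => ES_field J a (x t) (theta t) ord0 i).
Proof.
move=> cJ cx ct; under eq_fun do rewrite mxE.
have csin j : continuous (fun t => sin (theta t ord0 j)).
  move=> t; apply: (@continuous_comp _ _ _ (fun t => theta t ord0 j) sin).
    exact: (@continuous_coord R n _ theta j ct).
  exact: continuous_sin.
have ccos j : continuous (fun t => cos (theta t ord0 j)).
  move=> t; apply: (@continuous_comp _ _ _ (fun t => theta t ord0 j) cos).
    exact: (@continuous_coord R n _ theta j ct).
  exact: continuous_cos.
move=> t; apply: cvgM; last first.
  by apply: continuous_prodE => j _ {}t; exact: (cvgM (ccos j t) (ccos j t)).
apply: cvgM; last exact: csin.
apply: cvgM; first exact: cvg_cst.
apply: (@continuous_comp _ _ _ (fun t => x t + a *: map_mx sin (theta t)) J); last exact: cJ.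
apply: continuous_rVP => j {}t; under eq_fun do rewrite !mxE.
apply: cvgD; first exact: (@continuous_coord R n _ x j cx).
by apply: cvgM; [exact: cvg_cst|exact: csin].
Qed.

(** The property carried from separable polynomials to [J] in the limit: one family [dP] describes
    both the smoothed cost and the averaged field. *)
Definition averageable P (dP : 'I_n -> 'rV[R]_n -> R) := [/\ continuous P,
  forall i x, is_derive x (delta_mx ord0 i : 'rV[R]_n) (J_avg a P) (dP i x) &
  forall B i, mean_value (fun (x : {x : 'rV[R]_n | `|x| <= B}) t =>
    ES_field P a (sval x) (t *: w) ord0 i) (fun z => - dP i (sval z))].

(** Uniform closeness of the costs alone controls their smoothed gradients, because these are
    averages of fields that involve only values of the cost. *)
Lemma averageable_dist P dP Q dQ B c : averageable P dP -> averageable Q dQ ->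
  (forall y, `|y| <= B + a -> `|P y - Q y| <= c) ->
  forall i x, `|x| <= B -> `|dP i x - dQ i x| <= D * c.
Proof.
move=> [_ _ mP] [_ _ mQ] h i x xB.
have := @mean_value_le R _ _ _ _ _ (exist (fun x => is_true (`|x| <= B)) x xB)
  (D * c) (mP B i) (mQ B i).
rewrite /= opprK addrC distrC (distrC _ (dQ i x)); apply => t.
apply: ES_field_dist; apply: h.
by apply: (le_trans (ler_normD _ _)); rewrite lerD// normr_dither.
Qed.

Lemma norm_increment_le (f df : R -> R) c :
  (forall t : R, `|t| <= 1 -> is_derive t 1 f (df t)) ->
  (forall t, `|t| <= 1 -> `|df t| <= c) ->
  forall h, `|h| <= 1 -> `|f h - f 0| <= c * `|h|.
Proof.
move=> hf hdf h; rewrite ler_norml => /andP[h1 h2].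
have main u v : -1 <= u -> u <= v -> v <= 1 -> `|f v - f u| <= c * (v - u).
  move=> u1 uv v1; have sub t : u <= t -> t <= v -> `|t| <= 1.
    by move=> ut tv; rewrite ler_norml; apply/andP; split; lra.
  have hf' t : t \in `]u, v[ -> is_derive t 1 f (df t).
    by rewrite in_itv/= => /andP[/ltW ut /ltW tv]; apply: hf; exact: sub.
  have cf : {within `[u, v], continuous f}.
    apply: continuous_in_subspaceT => t; rewrite inE/= in_itv/= => /andP[ut tv].
    exact: is_derive_continuous (hf t (sub t ut tv)).
  have [t tI ->] := MVT_segment uv hf' cf.
  rewrite normrM [X in _ * X]ger0_norm ?subr_ge0//.
  apply: ler_wpM2r; first by rewrite subr_ge0.
  by move: tI; rewrite in_itv/= => /andP[ut tv]; apply: hdf; exact: sub.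
have [h0|/ltW h0] := leP 0 h.
  by rewrite (ger0_norm h0) -[in leRHS](subr0 h); apply: main => //; lra.
by rewrite (ler0_norm h0) distrC -(sub0r h); apply: main => //; lra.
Qed.

Section limit.
Variable J : 'rV[R]_n -> R.
Hypothesis J_cont : continuous J.
Hypothesis J_approx : forall B eta, 0 < eta -> exists P dP,
  averageable P dP /\ forall y, `|y| <= B -> `|J y - P y| <= eta.

(* Two approximations [P] and [Q] of [J] have close averaged fields, hence close
   gradients of the smoothed costs; then [Q] tends to [J]. *)
Lemma J_avg_increment_approx B eta i : 0 < eta -> exists P dP, [/\ averageable P dP,
  forall y, `|y| <= B + 1 + a -> `|J y - P y| <= eta &
  forall x h, `|x| <= B -> `|h| <= 1 ->
    `|(J_avg a P (h *: delta_mx ord0 i + x) - J_avg a P x) -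
      (J_avg a J (h *: delta_mx ord0 i + x) - J_avg a J x)| <= D * (2 * eta) * `|h|].
Proof.
move=> eta0; have [P [dP [avP JP]]] := J_approx (B + 1 + a) eta0.
exists P, dP; split => // x h xB h1; apply/ler_addgt0Pr => d d0.
pose C : R := 2 ^+ n * (2 / pi) ^+ n.
have C0 : 0 <= C by rewrite mulr_ge0 ?exprn_ge0// divr_ge0// pi_ge0.
have C1 : 0 < 2 * C + 1 by rewrite ltr_wpDl// mulr_ge0.
(* The smoothed costs of [J] and [Q] will differ by at most [C * m], at two points; together this
   stays below [d]. *)
have m0 : 0 < Num.min eta (d / (2 * C + 1)) by rewrite lt_min eta0 divr_gt0.
have [Q [dQ [avQ JQ]]] := J_approx (B + 1 + a) m0.
set m := Num.min _ _ in m0 JQ.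
have m_eta : m <= eta by rewrite ge_min lexx.
have m_d : m * (2 * C + 1) <= d by rewrite -ler_pdivlMr// ge_min lexx orbT.
have box t : `|t| <= 1 -> `|t *: delta_mx ord0 i + x| <= B + 1.
  move=> t1; apply: (le_trans (ler_normD _ _)); rewrite addrC lerD// normrZ.
  rewrite -[leRHS]mul1r; apply: ler_pM => //.
  apply: normr_rV_le => // j; rewrite mxE.
  by case: (_ && _); rewrite ?normr0 ?normr1.
have PQ i' y : `|y| <= B + 1 -> `|dP i' y - dQ i' y| <= D * (2 * eta).
  apply: (averageable_dist avP avQ) => {}y yB.
  have := ler_distD (J y) (P y) (Q y); rewrite (distrC (P y) (J y)).
  by have := JP y yB; have := JQ y yB; lra.
have [cP derP _] := avP; have [cQ derQ _] := avQ.
have h2 := @norm_increment_le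
  (fun t => J_avg a P (t *: delta_mx ord0 i + x) - J_avg a Q (t *: delta_mx ord0 i + x))
  (fun t => dP i (t *: delta_mx ord0 i + x) - dQ i (t *: delta_mx ord0 i + x))
  (D * (2 * eta)) _ _ h h1.
have {}h2 := h2 (fun t _ => is_deriveB ((is_derive_line _ _ _ _ _).1 (derP i _))
  ((is_derive_line _ _ _ _ _).1 (derQ i _))) (fun t t1 => PQ i _ (box t t1)).
have QJ y : `|y| <= B + 1 -> `|J_avg a J y - J_avg a Q y| <= C * m.
  move=> yB; rewrite /C -mulrA (mulrC _ m); apply: J_avg_dist => //.
    exact: ltW.
  move=> z zy; apply: JQ; apply: (le_trans zy); rewrite lerD2r//.
have h3 := QJ _ (box h h1).
have h4 : `|J_avg a J x - J_avg a Q x| <= C * m.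
  by apply: QJ; apply: (le_trans xB); rewrite lerDl.
rewrite /= scale0r add0r in h2.
move: h2 h3 h4.
set p1 := J_avg a P _; set q1 := J_avg a Q _; set p0 := J_avg a P _.
set q0 := J_avg a Q _; set j1 := J_avg a J _; set j0 := J_avg a J _ => h2 h3 h4.
rewrite (_ : _ - _ = (p1 - q1 - (p0 - q0)) - ((j1 - q1) - (j0 - q0))); last by ring.
apply: (le_trans (ler_normB _ _)).
have := ler_normB (j1 - q1) (j0 - q0); lra.
Qed.

(** The order of quantifiers matters: [P] serves the whole box and only the range of [h] depends on
    [x]. The difference quotients are thus Cauchy at each point, while [dP] approximates their limit
    uniformly. *)
Lemma derivable_J_avg_approx B eta i : 0 < eta -> exists P dP, [/\ averageable P dP,
  forall y, `|y| <= B + 1 + a -> `|J y - P y| <= eta &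
  forall x, `|x| <= B -> \forall h \near (0 : R)^',
    `|dP i x - h^-1 *: (J_avg a J (h *: delta_mx ord0 i + x) - J_avg a J x)|
      <= (2 * D + 1) * eta].
Proof.
move=> eta0; have [P [dP [avP JP hP]]] := J_avg_increment_approx B i eta0.
exists P, dP; split => // x xB.
have [_ /(_ i x) [dPx dPE] _] := avP.
have {}dPx : h^-1 *: (J_avg a P (h *: delta_mx ord0 i + x) - J_avg a P x)
    @[h --> (0 : R)^'] --> dP i x by rewrite -dPE.
near=> h.
have h0 : h != 0 by near: h; exact: nbhs_dnbhs_neq.
have h1 : `|h| <= 1 by near: h; exact: dnbhs0_le.
have h2 : `|dP i x - h^-1 *: (J_avg a P (h *: delta_mx ord0 i + x) - J_avg a P x)|
    <= eta.
  by near: h; exact: (cvgrPdist_le _ _).1 dPx _ eta0.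
have := hP x h xB h1; set p := _ - J_avg a P x in h2 *; set j := _ - J_avg a J x.
move=> h3.
have h4 : `|h^-1 *: p - h^-1 *: j| <= D * (2 * eta).
  rewrite -scalerBr normrZ normfV mulrC ler_pdivrMr ?normr_gt0//.
have := ler_distD (h^-1 *: p) (dP i x) (h^-1 *: j); lra.
Unshelve. all: by end_near. Qed.

Lemma derivable_J_avg x i : derivable (J_avg a J) x (delta_mx ord0 i : 'rV[R]_n).
Proof.
apply: cauchy_cvg; apply: cauchy_exP => e e0.
have D1 : 0 < 2 * D + 1 by rewrite ltr_wpDl// mulr_ge0.
have eta0 : 0 < e / 2 / (2 * D + 1) by rewrite !divr_gt0.
have [P [dP [_ _ h]]] := derivable_J_avg_approx `|x| i eta0.
exists (dP i x); apply: filterS (h x (lexx _)) => t ht.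
rewrite -ball_normE/=; apply: (le_lt_trans ht).
by rewrite mulrC divfK ?gt_eqF// ltr_pdivrMr// ltr_pMr// ltr1n.
Qed.

Lemma averageable_limit : averageable J (fun i x => 'D_(delta_mx ord0 i) (J_avg a J) x).
Proof.
split => //.
  by move=> i x; apply: derivableP; exact: derivable_J_avg.
move=> B i; apply: mean_value_limit.
  move=> x; apply: (@continuous_ES_field_along J (fun=> sval x)) => //.
    by move=> t; exact: cvg_cst.
  apply: continuous_rVP => j t; under eq_fun do rewrite mxE.
  by apply: cvgM; [exact: cvg_id|exact: cvg_cst].
move=> e e0.
have D1 : 0 < 2 * D + 1 by rewrite ltr_wpDl// mulr_ge0.
have eta0 : 0 < e / (2 * D + 1) by rewrite divr_gt0.
have [P [dP [avP JP h]]] := derivable_J_avg_approx B i eta0.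
set eta := e / _ in eta0 JP h.
have etaE : (2 * D + 1) * eta = e by rewrite /eta mulrC divfK// gt_eqF.
exists (fun z t => ES_field P a (sval z) (t *: w) ord0 i), (fun z => - dP i (sval z)).
split.
- by case: avP.
- move=> [x xB] t /=; apply: (@le_trans _ _ (D * eta)); last by rewrite -etaE; nra.
  apply: ES_field_dist; apply: JP; apply: (le_trans (ler_normD _ _)).
  by have := normr_dither (t *: w); lra.
- move=> [x xB] /=; rewrite opprK addrC; apply/ler_addgt0Pr => d d0.
  have dJ : h^-1 *: (J_avg a J (h *: delta_mx ord0 i + x) - J_avg a J x)
      @[h --> (0 : R)^'] --> 'D_(delta_mx ord0 i) (J_avg a J) x.
    exact: derivable_J_avg.
  have [t [t1 t2]] := filter_ex (filterI (h x xB) ((cvgrPdist_le _ _).1 dJ _ d0)).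
  rewrite etaE in t1.
  rewrite distrC in t2.
  have := ler_distD (t^-1 *: (J_avg a J (t *: delta_mx ord0 i + x) - J_avg a J x)) (dP i x)
    ('D_(delta_mx ord0 i) (J_avg a J) x); lra.
Qed.

End limit.

Lemma averageable_locally_lipschitz J : locally_lipschitz J ->
  averageable J (fun i x => 'D_(delta_mx ord0 i) (J_avg a J) x).
Proof.
move=> lJ; apply: averageable_limit; first exact: locally_lipschitz_continuous.
move=> B eta eta0.
have [L L0 hL] := lipschitz_on_box lJ (`|B| + 1).
have B0 : 0 < `|B| + 1 by rewrite ltr_wpDl.
have [N [c [p h]]] := separable_approximation B0 L0 eta0 hL.
exists (separable_poly c p), (separable_partial a c p); split.
  split; first exact: continuous_separable_poly.
  - by move=> i x; exact: is_derive_J_avg_separable.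
  - by move=> C i; apply: mean_value_ES_separable => //; rewrite gt_eqF.
move=> y yB; apply: h; apply: (le_trans yB).
by apply: (le_trans (ler_norm B)); rewrite lerDl.
Qed.

End averaging.

(** * Closeness of solutions on bounded time intervals *)

Section clamp.
Context {R : realType} {n : nat} (B : R).
Hypothesis B_ge0 : 0 <= B.

(** The retraction onto the box of radius [B], nonexpansive for the sup norm: a field precomposed
    with it is bounded and globally Lipschitz whenever it is so on the box. *)
Definition clamp (x : 'rV[R]_n) : 'rV[R]_n :=
  \row_i Num.max (- B) (Num.min B (x ord0 i)).

Lemma clamp_le x : `|clamp x| <= B.
Proof.
apply: normr_rV_le => // i; rewrite mxE ler_norml le_max lexx/= ge_max.
by rewrite ge_min lexx andbT; move: B_ge0; lra.
Qed.

Lemma clamp_id x : `|x| <= B -> clamp x = x.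
Proof.
move=> xB; apply/rowP => i; rewrite mxE.
have := le_trans (normr_coord x i) xB; rewrite ler_norml => /andP[x1 x2].
by rewrite (min_idPr x2) (max_idPr x1).
Qed.

Lemma clamp_dist x y : `|clamp x - clamp y| <= `|x - y|.
Proof.
apply: normr_rV_le => // i; apply: le_trans (normr_coord (x - y) i).
rewrite !mxE; move: (x ord0 i) (y ord0 i) => u v.
have B0 := B_ge0; have BB : - B <= B by lra.
have clE r : Num.max (- B) (Num.min B r) =
    if B <= r then B else if r <= - B then - B else r.
  by case: (leP B r) => h; [exact: max_idPr|case: (leP r (- B))].
rewrite !clE; case: (leP B u) => ?; case: (leP B v) => ?;
  case: (leP u (- B)) => ?; case: (leP v (- B)) => ?;
  rewrite ler_norml; apply/andP; split; case: (ger0P (u - v)) => ?; lra.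
Qed.

Lemma continuous_clamp : continuous clamp.
Proof.
apply: continuous_rVP => i; under eq_fun do rewrite mxE.
move=> x; apply: (@continuous_comp _ _ _ (fun x : 'rV[R]_n => x ord0 i)
  (fun u => Num.max (- B) (Num.min B u))); first exact: coord_continuous.
apply: continuous_max; first exact: cvg_cst.
by apply: continuous_min; [exact: cvg_cst|exact: cvg_id].
Qed.

End clamp.

Section closeness.
Context {R : realType} {n : nat} (J : 'rV[R]_n -> R) (a : R) (w : 'rV[R]_n).
Hypotheses (J_lip : locally_lipschitz J) (a_gt0 : 0 < a)
  (w_indep : rationally_independent w).

Let F (x : 'rV[R]_n) (tau : R) := ES_field J a x (tau *: w).
Let Fbar (x : 'rV[R]_n) : 'rV[R]_n := - gradient (J_avg a J) x.

Let mean_F B i : mean_value (fun (x : {x : 'rV[R]_n | `|x| <= B}) tau =>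
  F (sval x) tau ord0 i) (fun x => Fbar (sval x) ord0 i).
Proof.
have [_ _ /(_ B i)] := averageable_locally_lipschitz a_gt0 w_indep J_lip.
by move=> h; apply: (mean_value_ext h) => // x; rewrite /Fbar !mxE.
Qed.

(** The constants for [F] come from [J] on the box enlarged by the dither amplitude [a]; those for
    [Fbar] are inherited by averaging, which shows that the smoothed gradient is Lipschitz on
    boxes. *)
Lemma ES_field_lipschitz_bounded B : 0 <= B -> exists L M, [/\ 0 <= L /\ 0 <= M,
  forall x y tau, `|x| <= B -> `|y| <= B -> `|F x tau - F y tau| <= L * `|x - y|,
  forall x tau, `|x| <= B -> `|F x tau| <= M,
  forall x y, `|x| <= B -> `|y| <= B -> `|Fbar x - Fbar y| <= L * `|x - y| &
  forall x, `|x| <= B -> `|Fbar x| <= M].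
Proof.
move=> B0.
have [L L0 hL] := lipschitz_on_box J_lip (B + a).
have [C hC] := bounded_on_box J_lip (B + a).
pose D : R := 2 ^+ n / a.
have D0 : 0 <= D by rewrite divr_ge0 ?exprn_ge0// ltW.
have box x tau : `|x| <= B -> `|x + a *: map_mx sin (tau *: w)| <= B + a.
  move=> xB; apply: (le_trans (ler_normD _ _)).
  by rewrite lerD// normr_dither.
have C0 : 0 <= C.
  apply: (le_trans (normr_ge0 _) (hC 0 _)).
  by rewrite normr0 addr_ge0// ltW.
have FL x y tau i : `|x| <= B -> `|y| <= B ->
    `|F x tau ord0 i - F y tau ord0 i| <= D * L * `|x - y|.
  move=> xB yB; rewrite -mulrA; apply: ES_field_dist => //.
  apply: (le_trans (hL _ _ (box x tau xB) (box y tau yB))).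
  by rewrite opprD addrACA subrr addr0.
have FM x tau i : `|x| <= B -> `|F x tau ord0 i| <= D * C.
  (* A bound on the field is its distance to the field of the zero cost. *)
  move=> xB; have -> : F x tau ord0 i =
      F x tau ord0 i - ES_field (fun=> 0) a x (tau *: w) ord0 i.
    by rewrite [ES_field (fun=> 0) _ _ _ _ _]mxE mulr0 !mul0r subr0.
  by apply: ES_field_dist => //; rewrite subr0; apply: hC; exact: box.
have mF x (xB : `|x| <= B) i := mean_value_comp (fun _ : unit =>
  exist (fun x : 'rV[R]_n => is_true (`|x| <= B)) x xB) (mean_F B i).
exists (D * L), (D * C); split; first by split; exact: mulr_ge0.
- move=> x y tau xB yB; apply: normr_rV_le; first by apply: mulr_ge0 => //; exact: mulr_ge0.
  by move=> i; rewrite !mxE; have := FL x y tau i xB yB; rewrite !mxE.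
- by move=> x tau xB; apply: normr_rV_le; [exact: mulr_ge0|move=> i; exact: FM].
- move=> x y xB yB; apply: normr_rV_le; first by apply: mulr_ge0 => //; exact: mulr_ge0.
  move=> i; have := mean_value_le (x := tt) (mF x xB i) (mF y yB i)
    (fun tau => FL x y tau i xB yB).
  by rewrite /= !mxE.
- move=> x xB; apply: normr_rV_le; first exact: mulr_ge0.
  move=> i; have := mean_value_le (x := tt) (r := D * C) (mF x xB i)
    (mean_value_cst (fun _ : unit => 0)).
  by rewrite /= subr0; apply => tau; rewrite subr0; exact: FM.
Qed.

Lemma uniform_average B eta : 0 < eta -> exists2 T0, 0 < T0 &
  forall x i, `|x| <= B -> exists2 Psi : R -> R,
    forall tau : R, is_derive tau 1 Psi (F x tau ord0 i) &
    forall tau T, T0 <= T ->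
      `|Psi (tau + T) - Psi tau - T * Fbar x ord0 i| <= eta * T.
Proof.
move=> eta0.
have /choice[T0 hT0] i : exists T0, 0 < T0 /\ forall x, `|x| <= B ->
    exists2 Psi : R -> R, forall tau : R, is_derive tau 1 Psi (F x tau ord0 i) &
    forall tau T, T0 <= T ->
      `|Psi (tau + T) - Psi tau - T * Fbar x ord0 i| <= eta * T.
  have [Phi dPhi /(_ _ eta0)[T0 T00 h]] := mean_F B i.
  exists T0; split => // x xB.
  exists (Phi (exist _ x xB)) => [tau|tau T T0T]; first exact: (dPhi (exist _ x xB)).
  exact: (h (exist _ x xB)).
(* The sum dominates each [T0 i]; the [+ 1] keeps it positive for [n = 0]. *)
exists (\sum_i T0 i + 1).
  by rewrite ltr_wpDl// sumr_ge0// => i _; case: (hT0 i) => /ltW.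
move=> x i xB; have [_ /(_ x xB)[Psi dPsi h]] := hT0 i.
exists Psi => // tau T hT; apply: h; apply: le_trans hT.
rewrite (bigD1 i)//= -addrA lerDl addr_ge0//.
by rewrite sumr_ge0// => j _; case: (hT0 j) => /ltW.
Qed.

(* The quantity is the integral of [F (z s) (s / eps) - Fbar (z s)]. Over a step
   of length [h], [z] moves by at most [M * h], so up to [O(h^2)] it can be frozen
   at the start of the step, where the average applies as [h / eps >= T0]. *)
Lemma averaging_error (B T E : R) : 0 <= B -> 0 < T -> 0 < E ->
  exists2 eps0, 0 < eps0 & forall (eps t0 : R) (z Phi : R -> 'rV[R]_n),
    0 < eps < eps0 -> continuous z ->
    (forall t, t0 < t -> is_derive t 1 z (Fbar (z t))) ->
    (forall t, t0 <= t -> `|z t| <= B) ->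
    (forall t : R, is_derive t 1 Phi (F (z t) (t / eps))) ->
    forall t, t0 <= t <= t0 + T ->
      `|(Phi t - Phi t0) - (z t - z t0)| <= E.
Proof.
move=> B0 T0 E0.
have [L [M [[L0 M0] FL FM FbL FbM]]] := ES_field_lipschitz_bounded B0.
(* The final error is at most [T * eta + (2 * L * M * T + 2 * M) * h]; [h] and [eta] give each part
   half of [E]. *)
pose h := E / (2 * (2 * L * M * T + 2 * M + 1)).
have K0 : 0 < 2 * L * M * T + 2 * M + 1.
  by rewrite ltr_wpDl// addr_ge0 ?mulr_ge0// ltW.
have h0 : 0 < h by rewrite divr_gt0// mulr_gt0.
pose eta := E / (2 * T).
have eta0 : 0 < eta by rewrite divr_gt0// mulr_gt0.
have [S S0 hS] := uniform_average B eta0.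
exists (h / S); first by rewrite divr_gt0.
move=> eps t0 z Phi /andP[eps0]; rewrite ltr_pdivlMr// => epsS cz dz zB dPhi.
have heps : S <= h / eps by rewrite ler_pdivlMr// mulrC ltW.
have zM s t : t0 <= s -> s <= t -> `|z t - z s| <= M * (t - s).
  move=> t0s st; rewrite mulrBr.
  apply: (@norm_deriv_rV_le R n z (fun r => M * r) (fun r => Fbar (z r)) (fun=> M) s t st).
  - exact: continuous_subspaceT.
  - by apply: continuous_subspaceT => r; apply: cvgM; [exact: cvg_cst|].
  - move=> r; rewrite in_itv/= => /andP[sr _]; apply: dz; exact: le_lt_trans sr.
  - by move=> r _; have := is_derive_affine M 0 r; under eq_fun do rewrite addr0.
  - move=> r; rewrite in_itv/= => /andP[/ltW sr _]; apply: FbM; apply: zB.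
    exact: le_trans sr.
pose W i t := (Phi t ord0 i - Phi t0 ord0 i) - (z t ord0 i - z t0 ord0 i).
have dW i t : t0 < t ->
    is_derive t 1 (W i) (F (z t) (t / eps) ord0 i - Fbar (z t) ord0 i).
  move=> tt0; rewrite -[F _ _ _ _]subr0 -[Fbar _ _ _]subr0.
  have d1 := is_derive_coord i (dPhi t); have d2 := is_derive_coord i (dz t tt0).
  exact: is_deriveB (is_deriveB d1 (is_derive_cst _ _ _))
    (is_deriveB d2 (is_derive_cst _ _ _)).
have cPhi : continuous Phi by move=> t; exact: is_derive_continuous (dPhi t).
have cW i : continuous (W i).
  move=> t; have c1 := @continuous_coord R n _ Phi i cPhi t.
  have c2 := @continuous_coord R n _ z i cz t.
  by apply: cvgB; apply: cvgB => //; exact: cvg_cst.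
have crude i s t : t0 <= s -> s <= t -> `|W i t - W i s| <= 2 * M * (t - s).
  move=> t0s st; rewrite mulrBr.
  have d1 (r : R) : is_derive r 1 (fun r => 2 * M * r) (2 * M).
    by have := is_derive_affine (2 * M) 0 r; under eq_fun do rewrite addr0.
  have dW' r : r \in `]s, t[ ->
      is_derive r 1 (W i) (F (z r) (r / eps) ord0 i - Fbar (z r) ord0 i).
    by rewrite in_itv/= => /andP[sr _]; apply: dW; exact: le_lt_trans sr.
  apply: (norm_deriv_le st _ _ dW' (fun r _ => d1 r)).
  - exact: continuous_subspaceT.
  - by apply: continuous_subspaceT => r; exact: is_derive_continuous (d1 r).
  - move=> r; rewrite in_itv/= => /andP[/ltW sr _].
    have zr : `|z r| <= B by apply: zB; exact: le_trans sr.
    apply: (le_trans (ler_normB _ _)).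
    have := le_trans (normr_coord _ i) (FM _ (r / eps) zr).
    by have := le_trans (normr_coord _ i) (FbM _ zr); lra.
have step i s : t0 <= s -> `|W i (s + h) - W i s| <= (2 * L * M * h + eta) * h.
  move=> t0s; have zs := zB s t0s.
  have [Psi dPsi hPsi] := hS (z s) i zs.
  (* The same quantity as [W i] with the state frozen at [z s]; its increment over [h] is at most
     [eta * h] by the uniform average. *)
  pose V r := eps * Psi (r / eps) - Fbar (z s) ord0 i * r.
  have dV (r : R) : is_derive r 1 V (F (z s) (r / eps) ord0 i - Fbar (z s) ord0 i).
    have dP : is_derive r 1 (fun r => Psi (r / eps))
        (F (z s) (r / eps) ord0 i * eps^-1).
      apply: is_derive_ext (@is_derive_compE R Psi (fun r => eps^-1 * r + 0) r _ _
        (dPsi _) (is_derive_affine eps^-1 0 r)) => [q|]; by rewrite addr0 (mulrC eps^-1).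
    apply: is_deriveB.
      apply: is_derive_ext (is_derive_cmulE eps dP) => //.
      by field; rewrite gt_eqF.
    by have := is_derive_affine (Fbar (z s) ord0 i) 0 r; under eq_fun do rewrite addr0.
  have hV : `|V (s + h) - V s| <= eta * h.
    have := hPsi (s / eps) (h / eps) heps.
    rewrite -mulrDl -(ler_pM2l eps0) -[X in X * `|_|](gtr0_norm eps0) -normrM.
    rewrite (_ : eps * (eta * (h / eps)) = eta * h); last first.
      by field; rewrite gt_eqF.
    congr (`|_| <= _); rewrite /V; field.
    by rewrite gt_eqF.
  have sh : s <= s + h by rewrite lerDl ltW.
  have dWV r : r \in `]s, s + h[ -> is_derive r 1 (W i - V)
      ((F (z r) (r / eps) ord0 i - Fbar (z r) ord0 i) -
       (F (z s) (r / eps) ord0 i - Fbar (z s) ord0 i)).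
    rewrite in_itv/= => /andP[sr _].
    exact: is_deriveB (dW i r (le_lt_trans t0s sr)) (dV r).
  have d1 (r : R) : is_derive r 1 (fun r => 2 * L * M * h * r) (2 * L * M * h).
    by have := is_derive_affine (2 * L * M * h) 0 r; under eq_fun do rewrite addr0.
  have hWV : `|(W i - V) (s + h) - (W i - V) s| <=
      2 * L * M * h * (s + h) - 2 * L * M * h * s.
    apply: (norm_deriv_le sh _ _ dWV (fun r _ => d1 r)).
    - apply: continuous_subspaceT => r; apply: cvgB; first exact: cW.
      exact: is_derive_continuous (dV r).
    - by apply: continuous_subspaceT => r; exact: is_derive_continuous (d1 r).
    - move=> r; rewrite in_itv/= => /andP[/ltW sr /ltW rh].
      have zr : `|z r| <= B by apply: zB; exact: le_trans sr.
      have e1 := le_trans (normr_coord (F (z r) (r / eps) - F (z s) (r / eps)) i)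
        (FL _ _ (r / eps) zr zs).
      have e2 := le_trans (normr_coord (Fbar (z r) - Fbar (z s)) i) (FbL _ _ zr zs).
      rewrite [X in `|X|]mxE [X in _ + X]mxE in e1.
      rewrite [X in `|X|]mxE [X in _ + X]mxE in e2.
      have e3 := zM s r t0s sr.
      have e4 : L * `|z r - z s| <= L * M * h.
        rewrite -mulrA; apply: ler_wpM2l => //; apply: (le_trans e3).
        by apply: ler_wpM2l => //; lra.
      move: e1 e2; set f1 := F _ _ _ _; set f2 := F _ _ _ _.
      set g1 := Fbar _ _ _; set g2 := Fbar _ _ _ => e1 e2.
      rewrite (_ : _ - _ - _ = (f1 - f2) - (g1 - g2)); last by ring.
      by apply: (le_trans (ler_normB _ _)); lra.
  rewrite !fctE in hWV.
  rewrite (_ : W i (s + h) - W i s = (W i (s + h) - V (s + h) - (W i s - V s)) +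
    (V (s + h) - V s)); last by ring.
  by apply: (le_trans (ler_normD _ _)); lra.
have c0 : 0 <= 2 * L * M * h + eta.
  apply: addr_ge0; last exact: ltW.
  by apply: mulr_ge0; [apply: mulr_ge0 => //; exact: mulr_ge0|exact: ltW].
have W_t0 i : W i t0 = 0 by rewrite /W !subrr.
(* Steps are taken backwards from [t], so the only incomplete one lies next to [t0]. It is paid
   once, by the crude bound [2 * M * h]. *)
have bound i k t : t0 <= t -> t <= t0 + k.+1%:R * h ->
    `|W i t| <= (t - t0) * (2 * L * M * h + eta) + 2 * M * h.
  elim: k t => [|k IH] t t0t.
    rewrite mul1r => th; rewrite -[W i t]subr0 -(W_t0 i).
    apply: (le_trans (crude i t0 t (lexx _) t0t)).
    have e1 : 0 <= (t - t0) * (2 * L * M * h + eta).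
      by rewrite mulr_ge0// subr_ge0.
    have e2 : 2 * M * (t - t0) <= 2 * M * h by apply: ler_wpM2l; [rewrite mulr_ge0|lra].
    lra.
  have [th _|th] := leP t (t0 + k.+1%:R * h); first exact: IH.
  rewrite -natr1 mulrDl mul1r => th2.
  have k0 : 0 <= k%:R * h by apply: mulr_ge0 => //; exact: ltW.
  have t0h : t0 <= t - h by move: th; rewrite -natr1 mulrDl mul1r; lra.
  have e1 := IH (t - h) t0h; have e2 := step i (t - h) t0h.
  rewrite subrK in e2.
  have {}e1 : `|W i (t - h)| <= (t - h - t0) * (2 * L * M * h + eta) + 2 * M * h.
    by apply: e1; lra.
  have := ler_normD (W i t - W i (t - h)) (W i (t - h)); rewrite subrK.
  have : (t - t0) * (2 * L * M * h + eta) = (t - h - t0) * (2 * L * M * h + eta) +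
    (2 * L * M * h + eta) * h by ring.
  lra.
move=> t /andP[t0t tT]; apply: normr_rV_le; first exact: ltW.
move=> i; rewrite (_ : _ ord0 i = W i t); last by rewrite !mxE.
have [k hk] : exists k, T / h <= k.+1%:R.
  exists (Num.bound (T / h)); apply: (le_trans (ltW (archi_boundP _))).
    by rewrite divr_ge0// ltW.
  by rewrite ler_nat.
apply: (le_trans (bound i k t t0t _)).
  by apply: (le_trans tT); rewrite lerD2l -ler_pdivrMr.
apply: (@le_trans _ _ (T * (2 * L * M * h + eta) + 2 * M * h)).
  by rewrite lerD2r; apply: ler_wpM2r => //; lra.
have e1 : T * eta = E / 2 by rewrite /eta; field; rewrite gt_eqF.
have e2 : (2 * L * M * T + 2 * M + 1) * h = E / 2.
  by rewrite /h; field; rewrite gt_eqF.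
have : T * (2 * L * M * h + eta) + 2 * M * h =
  T * eta + (2 * L * M * T + 2 * M + 1) * h - h by ring.
lra.
Qed.

(** [F - Fbar] is small only after integration, so Gronwall's inequality cannot be applied to
    [x - z]. It is applied to [u], where [z] is replaced by the integral of [F] along [z]: the
    averaging error then enters the derivative only through [L * E]. *)
Lemma closeness (B T delta : R) : 0 <= B -> 0 < T -> 0 < delta ->
  exists2 eps0, 0 < eps0 & forall (eps t0 : R) (x z : R -> 'rV[R]_n),
    0 < eps < eps0 -> continuous x -> continuous z ->
    (forall t, t0 < t -> is_derive t 1 z (Fbar (z t))) ->
    (forall t, t0 <= t -> `|z t| <= B) ->
    (forall t, t0 < t -> is_derive t 1 x (F (clamp B (x t)) (t / eps))) ->
    x t0 = z t0 ->
    forall t, t0 <= t <= t0 + T -> `|x t - z t| <= delta.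
Proof.
move=> B0 T0 d0.
have [L [M [[L0 M0] FL FM _ _]]] := ES_field_lipschitz_bounded B0.
pose e := expR (3 * n%:R * L * T).
have e_gt0 : 0 < e by exact: expR_gt0.
have e1 : 1 <= e by rewrite -expR0 ler_expR !mulr_ge0// ltW.
(* The error is at most [E * e] for [u] plus [E] for averaging, and
   [E + E * e <= 2 * (E * e) = delta]. *)
pose E := delta / (2 * e).
have E0 : 0 < E by rewrite divr_gt0// mulr_gt0.
have [eps0 eps00 herr] := averaging_error B0 T0 E0.
exists eps0 => // eps t0 x z epsI cx cz dz zB dx xz t tI.
have ct : continuous (fun s : R => (s / eps) *: w).
  apply: continuous_rVP => i s; under eq_fun do rewrite mxE.
  by apply: cvgM; [apply: cvgM; [exact: cvg_id|exact: cvg_cst]|exact: cvg_cst].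
have [Phi dPhi] : exists Phi : R -> 'rV[R]_n,
    forall s : R, is_derive s 1 Phi (F (z s) (s / eps)).
  apply: exists_primitive_rV; apply: continuous_rVP => i.
  exact: continuous_ES_field_along (locally_lipschitz_continuous J_lip) cz ct.
pose u s := x s - (Phi s - Phi t0 + z t0).
have uE s : x s - z s = u s + ((Phi s - Phi t0) - (z s - z t0)).
  by rewrite /u; apply/rowP => i; rewrite !mxE; ring.
have /andP[t0t tT] := tI.
have du s : s \in `]t0, t[ ->
    is_derive s 1 u (F (clamp B (x s)) (s / eps) - F (z s) (s / eps)).
  rewrite in_itv/= => /andP[t0s _].
  rewrite -[F (z s) _]addr0 -[F (z s) _]subr0.
  exact: is_deriveB (dx s t0s) (is_deriveD (is_deriveB (dPhi s)
    (is_derive_cst _ _ _)) (is_derive_cst _ _ _)).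
have cPhi : continuous Phi by move=> s; exact: is_derive_continuous (dPhi s).
have cu : continuous u.
  move=> s; apply: cvgB; first exact: cx.
  apply: cvgD; last exact: cvg_cst.
  by apply: cvgB; [exact: cPhi|exact: cvg_cst].
have u0 : u t0 = 0 by rewrite /u subrr add0r xz subrr.
have err s : t0 <= s -> s <= t -> `|(Phi s - Phi t0) - (z s - z t0)| <= E.
  by move=> t0s st; apply: (herr eps) => //; rewrite t0s (le_trans st).
have ut : `|u t| <= E * e.
  have := @gronwall R n u _ L E t0 t L0 (ltW E0) t0t (continuous_subspaceT cu) du.
  move=> h; apply: (le_trans (h _ u0)).
    move=> s; rewrite in_itv/= => /andP[/ltW t0s /ltW st].
    have zs := zB s t0s.
    rewrite -{1}(clamp_id zs); apply: (le_trans (FL _ _ _ (clamp_le B0 _) (clamp_le B0 _))).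
    apply: ler_wpM2l => //; apply: (le_trans (clamp_dist B0 _ _)); rewrite uE.
    by apply: (le_trans (ler_normD _ _)); rewrite lerD2l err.
  apply: ler_wpM2l; first exact: ltW.
  by rewrite ler_expR; apply: ler_wpM2l; [rewrite !mulr_ge0|lra].
rewrite uE; apply: (le_trans (ler_normD _ _)).
have := err t t0t (lexx t).
have : delta = 2 * (E * e) by rewrite /E; field; rewrite gt_eqF.
have : E <= E * e by rewrite ler_pMr.
lra.
Qed.

End closeness.

(** * Practical stability *)

Section euclidean_norm.
Context {R : realType} {n : nat}.
Implicit Types u v : 'rV[R]_n.

Lemma enorm_ge0 v : 0 <= enorm v.
Proof. exact: sqrtr_ge0. Qed.

Lemma sqr_enorm v : enorm v ^+ 2 = \sum_i v ord0 i ^+ 2.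
Proof. by rewrite sqr_sqrtr// sumr_ge0// => i _; exact: sqr_ge0. Qed.

Lemma normr_le_enorm v : `|v| <= enorm v.
Proof.
apply: normr_rV_le; first exact: enorm_ge0.
move=> i; rewrite -sqrtr_sqr; apply: ler_wsqrtr; rewrite (bigD1 i)//= lerDl.
by apply: sumr_ge0 => j _; exact: sqr_ge0.
Qed.

Lemma enorm_le v : enorm v <= n%:R * `|v|.
Proof.
rewrite -(@ler_pXn2r _ 2) ?nnegrE ?enorm_ge0 ?mulr_ge0// sqr_enorm.
apply: (@le_trans _ _ (\sum_(i < n) `|v| ^+ 2)).
  apply: ler_sum => i _; rewrite -(real_normK (num_real (v ord0 i))).
  by rewrite ler_pXn2r ?nnegrE// normr_coord.
rewrite sumr_const card_ord -[leLHS]mulr_natl exprMn; apply: ler_wpM2r; first exact: sqr_ge0.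
by rewrite -natrX ler_nat; case: (n) => // k; rewrite expnS expn1 leq_pmulr.
Qed.

Lemma enorm_triangle u v : enorm (u + v) <= enorm u + enorm v.
Proof.
have A0 := enorm_ge0 u; have B0 := enorm_ge0 v.
rewrite -(@ler_pXn2r _ 2) ?nnegrE ?enorm_ge0 ?addr_ge0//.
have eq0 (z : 'rV[R]_n) : enorm z = 0 -> z = 0.
  by move=> z0; apply/eqP; rewrite -normr_le0 -z0 normr_le_enorm.
have [/eq0->|u0] := eqVneq (enorm u) 0.
  by rewrite add0r ler_pXn2r ?nnegrE ?addr_ge0 ?enorm_ge0// lerDr enorm_ge0.
have [/eq0->|v0] := eqVneq (enorm v) 0.
  by rewrite addr0 ler_pXn2r ?nnegrE ?addr_ge0 ?enorm_ge0// lerDl enorm_ge0.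
pose A := enorm u; pose B := enorm v; pose S := \sum_i u ord0 i * v ord0 i.
have AB : 0 < A * B by rewrite mulr_gt0// lt_def ?u0 ?v0.
have CS : S <= A * B.
  (* The expansion is [2 * A * B * (A * B - S)], so division by [A * B] gives Cauchy-Schwarz; this
     is why zero vectors were set aside. *)
  have : 0 <= \sum_i (B * u ord0 i - A * v ord0 i) ^+ 2.
    by apply: sumr_ge0 => i _; exact: sqr_ge0.
  rewrite (_ : \sum_i _ = B ^+ 2 * (\sum_i u ord0 i ^+ 2) -
    2 * (A * B) * S + A ^+ 2 * (\sum_i v ord0 i ^+ 2)).
    rewrite -!sqr_enorm -/A -/B => h.
    have {}h : 0 <= 2 * (A * B) * (A * B - S) by move: h; congr (_ <= _); ring.
    have AB2 : 0 < 2 * (A * B) by exact: mulr_gt0.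
    by move: h; rewrite pmulr_rge0// subr_ge0.
  rewrite !mulr_sumr -sumrB -big_split/=; apply: eq_bigr => i _; ring.
rewrite sqr_enorm (_ : \sum_i _ = (\sum_i u ord0 i ^+ 2) + 2 * S +
  (\sum_i v ord0 i ^+ 2)).
  by rewrite -!sqr_enorm -/A -/B; move: CS; nra.
rewrite mulr_sumr -!big_split/=; apply: eq_bigr => i _; rewrite mxE; ring.
Qed.

End euclidean_norm.

(** * Slow-time solutions, restarts and return to the original time *)

Section slow_time.
Context {R : realType} {n : nat}.

(** A solution is unconstrained before [t0]; extending it there by its initial value makes it
    continuous on the whole line, as the averaging estimates require. *)
Lemma continuous_max_within (z : R -> 'rV[R]_n) (t0 : R) :
  {within [set t | t0 <= t /\ (t%:E < +oo)%E], continuous z} ->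
  continuous (fun t => z (Num.max t t0)).
Proof.
move=> /subspace_continuousP cz t.
have in_set s : [set t | t0 <= t /\ (t%:E < +oo)%E] (Num.max s t0).
  by split; [rewrite le_max lexx orbT|rewrite ltry].
move=> A hA; have h := cz _ (in_set t) A hA.
have cm : continuous (fun s : R => Num.max s t0).
  by move=> s; exact: (@continuous_max R R id (fun=> t0) s (@cvg_id _ _)
    (@cst_continuous _ _ t0 s)).
have h2 : \forall s \near t, [set t | t0 <= t /\ (t%:E < +oo)%E] (Num.max s t0) ->
    A (z (Num.max s t0)) := cm t _ h.
by apply: filterS h2 => s; apply; exact: in_set.
Qed.

Lemma solution_continuous (g : R -> 'rV[R]_n -> 'rV[R]_n) (t0 : R) x0 z :
  is_solution g t0 x0 +oo%E z -> exists z', [/\ z' t0 = x0, continuous z',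
    forall t, t0 < t -> is_derive t 1 z' (g t (z' t)) &
    forall t, t0 <= t -> z' t = z t].
Proof.
move=> [_ z0 cz dz]; exists (fun t => z (Num.max t t0)).
have e t : t0 <= t -> z (Num.max t t0) = z t by move=> t0t; rewrite max_l.
split => //; first by rewrite e.
- exact: continuous_max_within.
move=> t t0t; rewrite e ?ltW//.
apply: near_eq_is_derive (dz t t0t (ltry _)).
by near=> s; rewrite e// ltW//; near: s; exact: lt_nbhsr.
Unshelve. all: by end_near. Qed.

Lemma is_solution_global (g : R -> 'rV[R]_n -> 'rV[R]_n) (t0 : R) x0 x :
  x t0 = x0 -> continuous x ->
  (forall t, t0 < t -> is_derive t 1 x (g t (x t))) ->
  is_solution g t0 x0 +oo%E x.
Proof.
move=> x0E cx dx; split => //; first exact: ltry.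
- exact: continuous_subspaceT.
- by move=> t t0t _; exact: dx.
Qed.

Variables (J : 'rV[R]_n -> R) (a : R) (w p : 'rV[R]_n) (beta : R -> R -> R).
Hypotheses (n_gt0 : (0 < n)%N) (J_lip : locally_lipschitz J) (a_gt0 : 0 < a)
  (w_indep : rationally_independent w) (beta_KL : class_KL beta).
Hypothesis p_GUAS : forall (t0 : R) (x0 : 'rV[R]_n),
  solutions_global_with (fun (_ : R) z => - gradient (J_avg a J) z) t0 x0
    (fun t z => enorm (z - p) <= beta (enorm (x0 - p)) (t - t0)).

Let beta_ge0 r s : 0 <= r -> 0 <= s -> 0 <= beta r s.
Proof. by case: beta_KL => h _ _ _; exact: h. Qed.

Let beta_mono r1 r2 s : 0 <= r1 -> r1 <= r2 -> 0 <= s -> beta r1 s <= beta r2 s.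
Proof.
case: beta_KL => _ _ h _ r10; rewrite le_eqVlt => /predU1P[->//|r12] s0.
by apply: ltW; apply: (h s s0).2.
Qed.

Let beta_decr r s1 s2 : 0 < r -> 0 <= s1 -> s1 <= s2 -> beta r s2 <= beta r s1.
Proof. by case: beta_KL => _ _ _ h r0 s10 s12; exact: (h r r0).1. Qed.

Let beta_small e : 0 < e -> exists2 d, 0 < d & beta d 0 <= e.
Proof.
move=> e0; case: beta_KL => b0 cb bz _.
have /subspace_continuousP/(_ (0, 0) (conj (lexx _) (lexx _))) := cb.
move=> /cvgrPdist_le/(_ e e0).
have b00 : beta 0 0 = 0 by exact: (bz 0 (lexx _)).1.
move=> /nbhs_ballP[d /= d0 h].
have d2 : 0 < d / 2 by rewrite divr_gt0.
exists (d / 2) => //.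
have h' : `|beta 0 0 - beta (d / 2) 0| <= e.
  apply: (h (d / 2, 0)); last by split => //; exact: ltW.
  split => /=; last exact: ballxx.
  rewrite -ball_normE/= sub0r normrN gtr0_norm//; lra.
by move: h'; rewrite b00 sub0r normrN ger0_norm// b0// ltW.
Qed.

Let beta_decay r e : 0 < r -> 0 < e -> exists2 T, 0 < T & beta r T <= e.
Proof.
move=> r0 e0; case: beta_KL => b0 _ _ /(_ r r0)[_ /cvgrPdist_le/(_ e e0)[M [_ hM]]].
exists (`|M| + 1); first by rewrite ltr_wpDl.
have := hM (`|M| + 1); rewrite sub0r normrN => h.
apply: (le_trans (ler_norm _)); apply: h.
by apply: (le_lt_trans (ler_norm M)); rewrite ltrDl.
Qed.

Lemma averaged_solution (t0 : R) x0 : exists z : R -> 'rV[R]_n,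
  [/\ z t0 = x0, continuous z,
    forall t, t0 < t -> is_derive t 1 z (- gradient (J_avg a J) (z t)) &
    forall t, t0 <= t -> enorm (z t - p) <= beta (enorm (x0 - p)) (t - t0)].
Proof.
have [[T [z mz]] /(_ T z mz)[TE zb]] := p_GUAS t0 x0.
case: mz => + _; rewrite TE => /solution_continuous[z' [z0 cz dz zz]].
by exists z'; split => // t t0t; rewrite zz//; exact: zb.
Qed.

(* Over a time [T] with [beta Delta T] small the solution follows the averaged
   one up to [delta]; it then lies in the ball of radius [2 * delta], from which
   the comparison is restarted at the times [t0 + k * T]. *)
Lemma slow_solution Delta nu : 0 < Delta -> 0 < nu ->
  exists2 eps_star, 0 < eps_star & forall eps (t0 : R) x0,
    0 < eps < eps_star -> enorm (x0 - p) <= Delta ->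
    exists x : R -> 'rV[R]_n, [/\ x t0 = x0, continuous x,
      forall t, t0 < t -> is_derive t 1 x (ES_field J a (x t) ((t / eps) *: w)) &
      forall t, t0 <= t -> enorm (x t - p) <= beta (enorm (x0 - p)) (t - t0) + nu].
Proof.
move=> D0 nu0.
have [d d0 hd] := @beta_small (nu / 2) (divr_gt0 nu0 (ltr0Sn _ 1)).
(* The radius [2 * delta] must be at most [d], where [beta d 0 <= nu / 2], and at most [Delta], so
   that restarts are allowed; [delta] itself is the comparison error, at most [nu / 2]. *)
pose delta := Num.min (d / 2) (Num.min (Delta / 2) (nu / 2)).
have delta0 : 0 < delta by rewrite !lt_min !divr_gt0.
have delta_d : 2 * delta <= d.
  have : delta <= d / 2 by rewrite ge_min lexx.
  lra.
have delta_D : 2 * delta <= Delta.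
  have : delta <= Delta / 2 by rewrite !ge_min lexx orbT.
  lra.
have delta_nu : delta <= nu / 2 by rewrite !ge_min lexx !orbT.
have [T T0 hT] := beta_decay D0 delta0.
(* The box holds the averaged solutions starting within [Delta] of [p] and, with the margin [nu],
   also the solution being constructed. *)
pose B := `|p| + beta Delta 0 + nu.
have bD0 : 0 <= beta Delta 0 by apply: beta_ge0 => //; exact: ltW.
have B0 : 0 <= B by rewrite !addr_ge0// ltW.
have nR : 0 < n%:R :> R by rewrite ltr0n.
(* Closeness is in the sup norm; the division by [n] pays for the passage to the Euclidean norm. *)
have [eps0 eps00 close] := closeness J_lip a_gt0 w_indep B0 T0 (divr_gt0 delta0 nR).
exists eps0 => // eps t0 x0 epsI x0D.
have [L [M [[L0 M0] FL FM _ _]]] := ES_field_lipschitz_bounded J_lip a_gt0 w_indep B0.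
pose g t x := ES_field J a (clamp B x) ((t / eps) *: w).
have [x [xt0 cx dx]] : exists x : R -> 'rV[R]_n, [/\ x t0 = x0, continuous x &
    forall t, t0 < t -> is_derive t 1 x (g t (x t))].
  apply: (@exists_solution R n g (L + 1) M); first by rewrite ltr_wpDl.
  - move=> y cy; apply: continuous_rVP => i.
    apply: (@continuous_ES_field_along R n a J (fun t => clamp B (y t))
      (fun t => (t / eps) *: w) i (locally_lipschitz_continuous J_lip)).
      move=> t; exact: (continuous_comp (cy t) (@continuous_clamp R n B (y t))).
    apply: continuous_rVP => j t; under eq_fun do rewrite mxE.
    by apply: cvgM; [apply: cvgM; [exact: cvg_id|exact: cvg_cst]|exact: cvg_cst].
  - move=> t u v; apply: (le_trans (FL _ _ _ (clamp_le B0 u) (clamp_le B0 v))).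
    apply: ler_pM => //; first by rewrite lerDl.
    exact: clamp_dist.
  - by move=> t u; apply: FM; exact: clamp_le.
have piece t1 : t0 <= t1 -> enorm (x t1 - p) <= Delta ->
    forall t, t1 <= t <= t1 + T ->
      enorm (x t - p) <= beta (enorm (x t1 - p)) (t - t1) + delta.
  move=> t01 x1D t tI; have /andP[t1t _] := tI.
  have [z [z0 cz dz zb]] := averaged_solution t1 (x t1).
  have zB s : t1 <= s -> `|z s| <= B.
    move=> t1s; rewrite -(subrK p (z s)); apply: (le_trans (ler_normD _ _)).
    have h1 := le_trans (normr_le_enorm _) (zb s t1s).
    have s0 : 0 <= s - t1 by rewrite subr_ge0.
    have h2 := beta_mono (enorm_ge0 _) x1D s0.
    have h3 := beta_decr D0 (lexx 0) s0.
    by rewrite /B; lra.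
  have dx1 s : t1 < s -> is_derive s 1 x (ES_field J a (clamp B (x s)) ((s / eps) *: w)).
    by move=> t1s; apply: dx; exact: le_lt_trans t1s.
  have := close eps t1 x z epsI cx cz dz zB dx1 (esym z0) t tI.
  rewrite ler_pdivlMr// mulrC => xz.
  rewrite -(subrKA (z t)); apply: (le_trans (enorm_triangle _ _)).
  by rewrite addrC lerD// ?zb//; apply: le_trans xz; exact: enorm_le.
have first t : t0 <= t <= t0 + T ->
    enorm (x t - p) <= beta (enorm (x0 - p)) (t - t0) + delta.
  by rewrite -xt0; apply: piece; rewrite ?xt0.
(* At the end of each period the averaged solution is within [beta Delta T <= delta] of [p], and the
   comparison adds another [delta]: errors do not accumulate. *)
have node k : enorm (x (t0 + k.+1%:R * T) - p) <= 2 * delta.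
  elim: k => [|k IH].
    rewrite mul1r; have := first (t0 + T); rewrite lexx lerDl ltW//= => /(_ isT).
    rewrite addrAC subrr add0r.
    by have := beta_mono (enorm_ge0 (x0 - p)) x0D (ltW T0); lra.
  set t1 := t0 + k.+1%:R * T in IH.
  have t01 : t0 <= t1 by rewrite lerDl mulr_ge0// ltW.
  have := piece t1 t01 (le_trans IH delta_D) (t1 + T).
  rewrite lexx lerDl ltW//= => /(_ isT); rewrite (addrAC t1 T (- t1)) subrr add0r.
  rewrite (_ : t0 + k.+2%:R * T = t1 + T); last first.
    by rewrite /t1 -[k.+2%:R]natr1; ring.
  have := beta_mono (enorm_ge0 (x t1 - p)) (le_trans IH delta_D) (ltW T0).
  lra.
have later k t : t0 + k%:R * T <= t <= t0 + k.+1%:R * T ->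
    enorm (x t - p) <= beta (enorm (x0 - p)) (t - t0) + nu.
  case: k => [|k].
    rewrite mul0r mul1r addr0 => /first h; apply: (le_trans h).
    by rewrite lerD2l; lra.
  set t1 := t0 + k.+1%:R * T => /andP[t1t tt1].
  have t01 : t0 <= t1 by rewrite lerDl mulr_ge0// ltW.
  have h1 := node k; rewrite -/t1 in h1.
  have tI : t1 <= t <= t1 + T.
    by rewrite t1t; move: tt1; rewrite /t1 -[k.+2%:R]natr1; lra.
  have h2 := piece t1 t01 (le_trans h1 delta_D) t tI.
  have s0 : 0 <= t - t1 by rewrite subr_ge0.
  have h3 := beta_mono (enorm_ge0 _) (le_trans h1 delta_d) s0.
  have h4 := beta_decr d0 (lexx 0) s0.
  have h5 : 0 <= beta (enorm (x0 - p)) (t - t0).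
    by apply: beta_ge0; [exact: enorm_ge0|rewrite subr_ge0 (le_trans t01)].
  lra.
have bound t : t0 <= t -> enorm (x t - p) <= beta (enorm (x0 - p)) (t - t0) + nu.
  move=> t0t; have y0 : 0 <= (t - t0) / T by rewrite divr_ge0 ?subr_ge0// ltW.
  have /andP[k1 k2] := truncn_itv y0.
  apply: (later (Num.truncn ((t - t0) / T))).
  move: k1 k2; rewrite ler_pdivlMr// ltr_pdivrMr// => k1 k2.
  by apply/andP; split; lra.
exists x; split => // t t0t.
(* The stability bound places [x t] in the box, so the clamped equation is the true one there. *)
rewrite -{1}(@clamp_id R n B (x t)); first exact: dx.
rewrite -(subrK p (x t)); apply: (le_trans (ler_normD _ _)).
have t0t' := ltW t0t.
have s0 : 0 <= t - t0 by rewrite subr_ge0.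
have h1 := le_trans (normr_le_enorm _) (bound t t0t').
have h2 := beta_mono (enorm_ge0 _) x0D s0.
have h3 := beta_decr D0 (lexx 0) s0.
by rewrite /B; lra.
Qed.

Lemma ES_systemE k omega : ES_system J a w k omega =
  fun t x => k *: ES_field J a x ((omega * t) *: w).
Proof.
apply/funext => t; apply/funext => x; apply/rowP => i.
rewrite /ES_system; have -> : dither_S a w omega t = a *: map_mx sin ((omega * t) *: w).
  by apply/rowP => j; rewrite !mxE mulrAC.
rewrite !mxE (mulrAC omega).
rewrite (eq_bigr (fun j => cos (((omega * t) *: w) ord0 j) ^+ 2)).
  by ring.
by move=> j _; rewrite !mxE mulrAC.
Qed.

Lemma ES_system_lipschitz k omega : 0 <= k ->
  lipschitz_on_balls (ES_system J a w k omega).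
Proof.
move=> k0 B; rewrite ES_systemE.
have B0 : 0 <= `|B| by [].
have [L [M [[L0 _] FL _ _ _]]] := ES_field_lipschitz_bounded J_lip a_gt0 w_indep B0.
exists (k * L); first exact: mulr_ge0.
move=> t u v uB vB; rewrite -scalerBr normrZ ger0_norm// -mulrA.
apply: ler_wpM2l => //; apply: FL; exact: le_trans (ler_norm B).
Qed.

(** The slow solution with [eps = k / omega], started at time [k * t0] and read at [k * t], solves
    the original system. Uniformity in the initial time absorbs the shift of phase. *)
Lemma ES_system_practical_stability Delta nu : 0 < Delta -> 0 < nu ->
  exists2 eps_star : R, 0 < eps_star &
    forall k omega : R, 0 < k -> 0 < omega -> k / omega < eps_star ->
    forall (t0 : R) (x0 : 'rV[R]_n), enorm (x0 - p) <= Delta ->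
      solutions_global_with (ES_system J a w k omega) t0 x0
        (fun t x => enorm (x - p) <= beta (enorm (x0 - p)) (k * (t - t0)) + nu).
Proof.
move=> D0 nu0; have [e e0 slow] := slow_solution D0 nu0.
exists e => // k omega k0 omega0 ke t0 x0 x0D.
have epsI : 0 < k / omega < e by rewrite divr_gt0.
have [x [x0E cx dx xb]] := slow (k / omega) (k * t0) x0 epsI x0D.
apply: (@global_solution_with _ _ _ _ _ (fun t => x (k * t))).
- exact/ES_system_lipschitz/ltW.
- apply: is_solution_global => //.
    move=> t; apply: (@continuous_comp _ _ _ (fun t => k * t) x); last exact: cx.
    by apply: cvgM; [exact: cvg_cst|exact: cvg_id].
  move=> t t0t; rewrite ES_systemE; apply: is_derive_rV => i.
  have kt : k * t0 < k * t by rewrite ltr_pM2l.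
  have dxi := is_derive_coord i (dx (k * t) kt).
  rewrite mxE (_ : omega * t = k * t / (k / omega)); last first.
    by field; rewrite !gt_eqF.
  have dk : is_derive t 1 (fun t => k * t) k.
    by have := is_derive_affine k 0 t; under eq_fun do rewrite addr0.
  rewrite mulrC.
  exact: (@is_derive_compE R (fun s => x s ord0 i) (fun t => k * t) t _ _ dxi dk).
- move=> t t0t; have := xb (k * t); rewrite ler_pM2l// => /(_ t0t).
  by rewrite mulrBr.
Qed.

End slow_time.

Theorem theorem4 (R : realType) (n : nat) (J : 'rV[R]_n -> R) (a : R)
    (omh : 'rV[R]_n) (xa : 'rV[R]_n) :
  (1 <= n)%N ->
  locally_lipschitz J ->
  0 < a ->
  (forall i, 0 < omh ord0 i) ->
  rationally_independent omh ->
  is_equilibrium (fun (_ : R) z => - gradient (J_avg a J) z) xa ->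
  GUAS (fun (_ : R) z => - gradient (J_avg a J) z) xa ->
  (forall eps0 : R, 0 < eps0 -> PGUAS eps0 (ES_slow_system J a omh) xa) /\
  (exists2 beta : R -> R -> R, class_KL beta &
     forall Delta nu : R, 0 < Delta -> 0 < nu ->
     exists2 eps_star : R, 0 < eps_star &
       forall k omega : R, 0 < k -> 0 < omega -> k / omega < eps_star ->
       forall (t0 : R) (x0 : 'rV[R]_n), enorm (x0 - xa) <= Delta ->
         solutions_global_with (ES_system J a omh k omega) t0 x0
           (fun t x => enorm (x - xa)
              <= beta (enorm (x0 - xa)) (k * (t - t0)) + nu)).
Proof.
move=> n0 lJ a0 _ w_indep _ [beta bKL hG].
have stab := ES_system_practical_stability n0 lJ a0 w_indep bKL hG.
split; last by exists beta.
move=> eps0 eps00; exists beta => // Delta nu D0 nu0.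
have [e e0 h] := stab Delta nu D0 nu0.
exists (Num.min e eps0); first by rewrite lt_min e0 eps00/= ge_min lexx orbT.
move=> t0 x0 eps x0D; rewrite lt_min => /andP[eps_gt0 /andP[epse _]].
(* The slow system is the original one with [k = 1] and [omega = eps^-1], so the estimate in
   original time contains the slow-time claim. *)
have -> : (fun t x => ES_slow_system J a omh t x eps) =
    ES_system J a omh 1 eps^-1.
  rewrite ES_systemE; apply/funext => t; apply/funext => x.
  by rewrite scale1r /ES_slow_system mulrC.
have := h 1 eps^-1 ltr01; rewrite invr_gt0 div1r invrK => /(_ eps_gt0 epse t0 x0 x0D).
by under eq_fun do under eq_fun do rewrite mul1r.
Qed.
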